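(* For $h\in\{1,2\}$, let $B_h\subseteq\mathbb{R}^{n_h}$ be given by facet-defining inequalities, $B_h=\{x\in\mathbb{R}^{n_h}: a_i^h\cdot x\le 1,\ \forall i\in I_h\}$, and let $S_h\subseteq\mathbb{R}^{n_h}$ be a polyhedrally-truncated affine lattice. Let $\mu\in(0,1)$. Then: (i) If $B_h$ is $S_h$-free for $h\in\{1,2\}$, then $\frac{B_1}{\mu}\Diamond\frac{B_2}{1-\mu}$ is $S_1\times S_2$-free. (ii) If $B_h$ is maximal $S_h$-free for $h\in\{1,2\}$, then $\frac{B_1}{\mu}\Diamond\frac{B_2}{1-\mu}$ is maximal $S_1\times S_2$-free. (iii) If $B_h$ is maximal $S_h$-free with the covering property for $h\in\{1,2\}$, then $\frac{B_1}{\mu}\Diamond\frac{B_2}{1-\mu}$ is maximal $S_1\times S_2$-free with the covering property.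
   Context: A lattice in $\mathbb{R}^n$ is a set $\Lambda=\{\lambda_1v_1+\dots+\lambda_nv_n:\lambda_i\in\mathbb{Z}\}$ with $v_1,\dots,v_n\in\mathbb{R}^n$ linearly independent. A truncated affine lattice is a set $S=(b+\Lambda)\cap C$ with $\Lambda$ a lattice in $\mathbb{R}^n$, $b\in\mathbb{R}^n\setminus\Lambda$ and $C\subseteq\mathbb{R}^n$ convex; it is polyhedrally-truncated if $\operatorname{conv}(S)$ is a polyhedron. If $S_1,S_2$ are polyhedrally-truncated affine lattices in $\mathbb{R}^{n_1},\mathbb{R}^{n_2}$, so is $S_1\times S_2$ in $\mathbb{R}^{n_1+n_2}$. A convex set $B$ is $S$-free if $\operatorname{int}(B)\cap S=\emptyset$, and maximal $S$-free if it is inclusion-wise maximal among $S$-free convex sets. ''Given by facet-defining inequalities'' means the index set is finite with exactly one inequality for each facet. Coproduct: for a convex set $C\subseteq\mathbb{R}^n$ with the origin in its interior, a prepolar of $C$ is a set $X$ whose polar $X^*=\{y: x\cdot y\le 1\ \forall x\in X\}$ equals $C$, and $C^\bullet$ denotes the smallest prepolar. For closed convex sets $C_1\subseteq\mathbb{R}^{n_1}$, $C_2\subseteq\mathbb{R}^{n_2}$ with the origin in their interiors, $C_1\Diamond C_2:=(C_1^\bullet\times C_2^\bullet)^*\subseteq\mathbb{R}^{n_1+n_2}$. For polyhedra $P_h=\{x\in\mathbb{R}^{n_h}: c_i^h\cdot x\le 1,\ i\in I_h\}$ given by facet-defining inequalities, this is $$P_1\Diamond P_2=\{(x,y)\in\mathbb{R}^{n_1}\times\mathbb{R}^{n_2}:(c_i^1,c_j^2)\cdot(x,y)\le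 1,\ \forall i\in I_1,\ \forall j\in I_2\}.$$ In particular $\frac{B_1}{\mu}\Diamond\frac{B_2}{1-\mu}=\{(x_1,x_2):(\mu a_i^1,(1-\mu)a_j^2)\cdot(x_1,x_2)\le 1,\ \forall i\in I_1,\ j\in I_2\}$. Here $\frac{B}{\mu}=\{x/\mu:x\in B\}$. Covering property: for a polyhedrally-truncated affine lattice $S\subseteq\mathbb{R}^n$ and a maximal $S$-free polyhedron $B=\{r: a_i\cdot r\le 1,\ i\in I\}$ given by facet-defining inequalities (so the origin is in its interior), and for $s\in B\cap S$, choose $k\in I$ with $a_k\cdot s=1$ (such $k$ exists, and the following set does not depend on the choice) and let $R(s,B)=\{r:(a_i-a_k)\cdot r\le 0,\ (a_i-a_k)\cdot(s-r)\le 0\ \forall i\in I\}$. Let $R(S,B)=\bigcup_{s\in B\cap S}R(s,B)$ and $W_S=\{w\in\mathbb{R}^n:s+\lambda w\in S\ \forall s\in S,\ \forall\lambda\in\mathbb{Z}\}$. Then $B$ has the covering property (with respect to $S$) if $R(S,B)+W_S=\mathbb{R}^n$. In (iii), $B_h$ has the covering property with respect to $S_h$ and the coproduct has it with respect to $S_1\times S_2$. *)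

(* Defs.v *)
From HB Require Import structures.
From mathcomp Require Import all_boot all_order all_algebra.
From mathcomp Require Import all_classical all_reals all_analysis.

Set Implicit Arguments.
Unset Strict Implicit.
Unset Printing Implicit Defensive.

Import Order.TTheory GRing.Theory Num.Theory.
Import numFieldNormedType.Exports.

Local Open Scope classical_set_scope.
Local Open Scope ring_scope.

Section Geometry.
Context {R : realType} {n : nat}.
Implicit Types (x y w : 'rV[R]_n) (A B C P F S L : set 'rV[R]_n).

Definition dotp x y : R := (x *m y^T) 0 0.

Definition convex_hull A : set 'rV[R]_n := smallest (@convex_set R 'rV[R]_n) A.

Definition is_polyhedron P : Prop :=
  exists (m : nat) (c : 'I_m -> 'rV[R]_n) (d : 'I_m -> R),
    P = [set x | forall i, dotp (c i) x <= d i].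

Definition is_lattice L : Prop :=
  exists V : 'M[R]_n, row_free V /\
    L = [set x | exists z : 'I_n -> int, x = \sum_(i < n) (z i)%:~R *: row i V].

Definition truncated_affine_lattice S : Prop :=
  exists (L : set 'rV[R]_n) (b : 'rV[R]_n) (C : set 'rV[R]_n),
    [/\ is_lattice L, ~ L b, convex_set C
      & S = [set b + x | x in L] `&` C].

Definition polyhedrally_truncated_affine_lattice S : Prop :=
  truncated_affine_lattice S /\ is_polyhedron (convex_hull S).

Definition S_free S B : Prop := convex_set B /\ B° `&` S = set0.

Definition maximal_S_free S B : Prop :=
  S_free S B /\
  forall B', S_free S B' -> B `<=` B' -> B' = B.

(* A contains d + 1 affinely independent points. *)
Definition affine_dim_ge A (d : nat) : Prop :=
  exists (x : 'rV[R]_n) (V : 'M[R]_(d, n)),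
    [/\ A x, forall i, A (x + row i V) & row_free V].

Definition affine_dim A (d : nat) : Prop :=
  affine_dim_ge A d /\ ~ affine_dim_ge A d.+1.

Definition face P F : Prop :=
  exists (c : 'rV[R]_n) (d : R),
    (forall x, P x -> dotp c x <= d) /\ F = [set x | P x /\ dotp c x = d].

Definition facet P F : Prop :=
  face P F /\ exists d, affine_dim F d /\ affine_dim P d.+1.

(* B = {x | a_i . x <= 1 for all i} with exactly one inequality per facet. *)
Definition facet_presentation (I : finType) (a : I -> 'rV[R]_n) B : Prop :=
  B = [set x | forall i, dotp (a i) x <= 1] /\
  set_bij [set: I] [set F | facet B F]
    (fun i => [set x | B x /\ dotp (a i) x = 1]).

Definition polar A : set 'rV[R]_n := [set y | forall x, A x -> dotp x y <= 1].

(* Prepolars are taken closed: over arbitrary sets there is in general no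
   smallest one.  For instance {1 - 1/k, 1/k - 1 | k >= 1} has polar [-1, 1],
   as does {1, -1}, but the two are disjoint. *)
Definition prepolar C : set (set 'rV[R]_n) := [set X | closed X /\ polar X = C].

(* The intersection of all prepolars.  When C is a polyhedron with facet
   presentation a it is the set of all a_i, which is itself a prepolar. *)
Definition smallest_prepolar C : set 'rV[R]_n := smallest (prepolar C) set0.

Definition scale_set (t : R) A : set 'rV[R]_n := [set t *: x | x in A].

(* R(s, B).  For s in B and in S with B S-free, some a_k . s = 1, and the
   condition on r is the same for every such k. *)
Definition region_at (I : finType) (a : I -> 'rV[R]_n) (s : 'rV[R]_n) :
    set 'rV[R]_n :=
  [set r | exists2 k, dotp (a k) s = 1 &
     forall i, dotp (a i - a k) r <= 0 /\ dotp (a i - a k) (s - r) <= 0].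

Definition lifting_region S (I : finType) (a : I -> 'rV[R]_n) B :
    set 'rV[R]_n :=
  \bigcup_(s in B `&` S) region_at a s.

Definition translation_vectors S : set 'rV[R]_n :=
  [set w | forall s, S s -> forall l : int, S (s + l%:~R *: w)].

(* The facet presentation of B is unique up to reindexing, so quantifying it
   existentially makes this a property of the set B. *)
Definition covering_property S B : Prop :=
  exists (I : finType) (a : I -> 'rV[R]_n),
    facet_presentation a B /\
    [set r + w | r in lifting_region S a B & w in translation_vectors S]
      = [set: 'rV[R]_n].

End Geometry.

Definition prod_set {R : realType} {n1 n2 : nat}
    (A1 : set 'rV[R]_n1) (A2 : set 'rV[R]_n2) : set 'rV[R]_(n1 + n2) :=
  [set x | A1 (lsubmx x) /\ A2 (rsubmx x)].

Definition coproduct {R : realType} {n1 n2 : nat}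
    (C1 : set 'rV[R]_n1) (C2 : set 'rV[R]_n2) : set 'rV[R]_(n1 + n2) :=
  polar (prod_set (smallest_prepolar C1) (smallest_prepolar C2)).

(* Main.v *)
Require Import Defs.
From HB Require Import structures.
From mathcomp Require Import all_boot all_order all_algebra.
From mathcomp Require Import all_classical all_reals all_analysis.
From mathcomp Require Import zify ring lra.

Set Implicit Arguments.
Unset Strict Implicit.
Unset Printing Implicit Defensive.

Import Order.TTheory GRing.Theory Num.Theory.
Import numFieldNormedType.Exports.

Local Open Scope classical_set_scope.
Local Open Scope ring_scope.

(** The coproduct is the polyhedron whose normals are the vectors
   [(mu a1_i, (1 - mu) a2_j)]: the normals of a polyhedron given by facets form
   its smallest prepolar, because every closed prepolar contains the normal of
   each facet ([prepolar_normal]). As each normal of the coproduct is a convex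
   combination of a normal of either factor, two claims are immediate. A pair of
   points that are not interior to the factors is not interior to the coproduct
   ([S_free_coproduct]), and a pair of points in lifting regions of the factors
   lies in a lifting region of the coproduct ([lifting_region_prod]).

   Maximality rests on a criterion: an [S]-free polyhedron with the origin in
   its interior is maximal if and only if each of its facets contains a point of
   [S] in its relative interior. Given the criterion, such points for a facet of
   each factor form such a point for the corresponding facet of the coproduct.
   The condition is sufficient ([maximal_S_free_of_strict]) since a larger convex
   set contains a point beyond some facet, and then has in its interior the
   points in the relative interior of this facet.

   Necessity ([facet_attained]) is the hard part. If the [k]-th facet of a
   maximal polyhedron has no such point, relaxing its inequality gives points of
   [S] approaching it from outside. Maximality is then used through the remark
   that a convex [S]-free set containing the polyhedron equals it. First, no
   functional [a i] tends to [-oo] along these points, as otherwise its inequality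
   could be dropped. So all functionals converge along them, and differences of
   the points are nearly killed by all functionals, but not entirely. Such
   differences can be chosen so that they translate [S] into itself; small
   translations have integer multiples that nearly follow a ray, so sweeping the
   polyhedron backwards along this ray keeps it [S]-free. The swept set therefore
   equals the polyhedron, which forces all functionals to be nonnegative along
   the ray ([limit_direction_ge0]). The same holds for the opposite ray, so all
   functionals vanish along the ray, contrary to its choice.

   That differences translate [S] into itself ([truncated_lattice_wqo]) is where
   the convex hull of [S] being a polyhedron matters. A facet of the hull is the
   hull of points of [S], so its directions are spanned by lattice vectors, and
   the functional defining it takes discrete values on [S]
   ([hull_functional_discrete]). A sequence in [S] on which such a functional is
   bounded above cannot keep increasing it, so that later points differ from
   earlier ones by recession directions of the hull. All the subsequences needed
   are chosen at once by an ultrafilter. *)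

(** * Linear functionals, half-spaces and interiors *)

Section Halfspaces.
Context {R : realType} {n : nat}.
Implicit Types (c x y u : 'rV[R]_n) (A P : set 'rV[R]_n).

Lemma dotpE c x : dotp c x = \sum_j c 0 j * x 0 j.
Proof. by rewrite /dotp mxE; apply: eq_bigr => j _; rewrite mxE. Qed.

Lemma dotpC c x : dotp c x = dotp x c.
Proof. by rewrite !dotpE; apply: eq_bigr => j _; rewrite mulrC. Qed.

Lemma dotpDr c x y : dotp c (x + y) = dotp c x + dotp c y.
Proof. by rewrite /dotp linearD mulmxDr mxE. Qed.

Lemma dotpZr c t x : dotp c (t *: x) = t * dotp c x.
Proof. by rewrite /dotp linearZ -scalemxAr mxE. Qed.

Lemma dotpNr c x : dotp c (- x) = - dotp c x.
Proof. by rewrite -scaleN1r dotpZr mulN1r. Qed.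

Lemma dotpBr c x y : dotp c (x - y) = dotp c x - dotp c y.
Proof. by rewrite dotpDr dotpNr. Qed.

Lemma dotp0r c : dotp c 0 = 0.
Proof. by rewrite -(scale0r 0) dotpZr mul0r. Qed.

Lemma dotpBl c c' x : dotp (c - c') x = dotp c x - dotp c' x.
Proof. by rewrite dotpC dotpBr !(dotpC x). Qed.

Lemma dotpZl t c x : dotp (t *: c) x = t * dotp c x.
Proof. by rewrite dotpC dotpZr dotpC. Qed.

Lemma dotpMn c x k : dotp c (x *+ k) = dotp c x *+ k.
Proof. by rewrite -scaler_nat dotpZr mulr_natl. Qed.

Definition dotpr := (dotpDr, dotpBr, dotpNr, dotpZr, dotpMn).

Lemma dotp_delta x j : dotp x (delta_mx 0 j) = x 0 j.
Proof.
rewrite dotpE (bigD1 j) //= mxE !eqxx mulr1 big1 ?addr0 // => i ij.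
by rewrite mxE (negbTE ij) andbF mulr0.
Qed.

Lemma dotp_gt0 c : c != 0 -> 0 < dotp c c.
Proof.
move=> c0; have sq j : 0 <= c 0 j * c 0 j by rewrite -expr2 sqr_ge0.
rewrite lt_neqAle dotpE sumr_ge0 ?andbT //.
apply/eqP => /esym/psumr_eq0P h; case/eqP: c0; apply/rowP => j.
by have /eqP := h (fun i _ => sq i) j isT; rewrite mulf_eq0 orbb mxE => /eqP.
Qed.

Lemma dotp_continuous c : continuous (dotp c).
Proof.
rewrite (_ : dotp c = fun y => \sum_j c 0 j * y 0 j); last first.
  by apply/funext => y; rewrite dotpE.
have add_cont : continuous (fun z : R * R => z.1 + z.2).
  by move=> z; apply: cvgD; [exact: cvg_fst|exact: cvg_snd].
apply: (continuous_big add_cont) => j _ x.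
have coord := @coord_continuous R 1 n 0 j x.
by apply: (@cvgM R _ (nbhs x)); [exact: cvg_cst|exact: coord].
Qed.

Lemma convexP A : convex_set A <->
  forall x y t, 0 <= t -> t <= 1 -> A x -> A y -> A (t *: x + (1 - t) *: y).
Proof.
split=> [cA x y t t0 t1 Ax Ay|cA x y t /set_mem Ax /set_mem Ay].
  have t01 : Itv.spec (@Itv.num_sem R) (Itv.Real `[0%Z, 1%Z]) t.
    by apply/and3P; split; rewrite ?num_real // bnd_simp.
  by have := cA x y (Itv.Def t01) (mem_set Ax) (mem_set Ay) => /set_mem.
by apply/mem_set/cA.
Qed.

Lemma hull_convex A : convex_set (convex_hull A).
Proof.
apply/convexP => x y t t0 t1 xA yA C [cC AC].
by move/convexP: (cC); apply => //; [apply: xA|apply: yA].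
Qed.

Lemma sub_hull A : A `<=` convex_hull A.
Proof. by move=> x Ax C [_]; apply. Qed.

Lemma hull_min A P : convex_set P -> A `<=` P -> convex_hull A `<=` P.
Proof. by move=> cP AP x; apply. Qed.

Lemma halfspaces_convex (I : Type) (c : I -> 'rV[R]_n) (e : I -> R) :
  convex_set [set x | forall i, dotp (c i) x <= e i].
Proof.
apply/convexP => x y t t0 t1 /= hx hy i; rewrite !dotpr.
by have := hx i; have := hy i; nra.
Qed.

Lemma interior_segment A x u : A° x ->
  exists2 d : R, 0 < d & forall t, `|t| <= d -> A (x + t *: u).
Proof.
move=> Ax; have h : (fun t : R => x + t *: u) @ 0 --> x.
  have : (fun t : R => x + t *: u) @ 0 --> x + (0 : R) *: u.
    by apply: cvgD; [exact: cvg_cst|apply: cvgZr_tmp; exact: cvg_id].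
  by rewrite scale0r addr0.
have /nbhs_ballP[d /= d0 dA] := h _ Ax.
exists (d / 2); first by lra.
move=> t td; apply: dA; rewrite /ball /= sub0r normrN.
by lra.
Qed.

Lemma interior_halfspaces (I : finType) (c : I -> 'rV[R]_n) (e : I -> R) x :
  (forall i, dotp (c i) x < e i) -> [set x | forall i, dotp (c i) x <= e i]° x.
Proof.
move=> h; have : \forall y \near x, forall i, dotp (c i) y < e i.
  apply: (@filter_forall _ I (fun i y => dotp (c i) y < e i) (nbhs x)) => i.
  apply: (dotp_continuous (c := c i) (x := x) (t := [set r | r < e i])).
  by apply: open_nbhs_nbhs; split; [exact: open_lt|exact: h].
by apply: filterS => y lt_y i; apply/ltW.
Qed.

(** An interior point can be pushed outwards along its own ray, which is why
   a positive bound valid on [A] is not attained there. *)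
Lemma interior_lt A c e x :
  0 < e -> (forall y, A y -> dotp c y <= e) -> A° x -> dotp c x < e.
Proof.
move=> e0 h /(interior_segment x)[d d0 /(_ d)].
by rewrite gtr0_norm // => /(_ (lexx _))/h; rewrite !dotpr; nra.
Qed.

Lemma interior_max_eq0 A c e x :
  (forall y, A y -> dotp c y <= e) -> A° x -> dotp c x = e -> c = 0.
Proof.
move=> h /(interior_segment c)[d d0 /(_ d)].
rewrite gtr0_norm // => /(_ (lexx _))/h; rewrite !dotpr => le_e xe.
by apply/eqP/negP => /negP/dotp_gt0; nra.
Qed.

(** Averaging, for each inequality that is not an implicit equality, a point
   at which it is strict gives a relative interior point of [P]. *)
Lemma common_strict_point (I : finType) (c : I -> 'rV[R]_n) (e : I -> R) P x :
  convex_set P -> P x -> (forall y, P y -> forall i, dotp (c i) y <= e i) ->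
  exists2 z, P z &
    forall i, dotp (c i) z < e i \/ forall y, P y -> dotp (c i) y = e i.
Proof.
move=> /convexP cP Px Pe.
suff [z Pz h] : exists2 z, P z & forall i, i \in enum I ->
    dotp (c i) z < e i \/ forall y, P y -> dotp (c i) y = e i.
  by exists z => // i; apply: h; rewrite mem_enum.
elim: (enum I) => [|i r [z Pz h]]; first by exists x.
have [tight|/existsNP[y /not_implyP[Py /eqP ny]]] :=
    pselect (forall y, P y -> dotp (c i) y = e i).
  by exists z => // j; rewrite inE => /predU1P[->|/h //]; right.
exists (2^-1 *: z + (1 - 2^-1) *: y); first by apply: cP => //; lra.
move=> j; have := Pe _ Pz j; have := Pe _ Py j => yj zj.
rewrite inE => /predU1P[ji|/h[lt_z|]]; last by right.
  left; rewrite !dotpr; have : dotp (c j) y < e j by rewrite lt_neqAle yj ji ny.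
  by lra.
by left; rewrite !dotpr; lra.
Qed.

End Halfspaces.

(** * Facets of polyhedra containing the origin in their interior *)

(** Used to choose one step length that respects finitely many constraints. *)
Lemma all_small {R : realType} (J : finType) (P : J -> R -> Prop) :
  (forall j, exists2 d, 0 < d & forall t, 0 < t -> t <= d -> P j t) ->
  exists2 d, 0 < d & forall t, 0 < t -> t <= d -> forall j, P j t.
Proof.
move=> h; suff [d d0 hd] : exists2 d, 0 < d & forall t, 0 < t -> t <= d ->
    forall j, j \in enum J -> P j t.
  by exists d => // t t0 td j; apply: hd => //; rewrite mem_enum.
elim: (enum J) => [|j s [d d0 hd]]; first by exists 1.
have [d' d'0 hd'] := h j; exists (Num.min d d'); first by rewrite lt_min d0.
move=> t t0; rewrite le_min => /andP[td td'] i; rewrite inE.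
by case/predU1P => [->|]; [exact: hd'|exact: hd].
Qed.

Section Facets.
Context {R : realType} {n : nat}.
Implicit Types (x y u c : 'rV[R]_n) (A F : set 'rV[R]_n).

Definition unit_halfspaces (I : finType) (a : I -> 'rV[R]_n) : set 'rV[R]_n :=
  [set x | forall i, dotp (a i) x <= 1].

(** A point in the relative interior of the [k]-th facet. *)
Definition strict_at (I : finType) (a : I -> 'rV[R]_n) (k : I) x : Prop :=
  dotp (a k) x = 1 /\ forall i, i != k -> dotp (a i) x < 1.

Lemma unit_halfspaces_interior (I : finType) (a : I -> 'rV[R]_n) x :
  (forall i, dotp (a i) x < 1) -> (unit_halfspaces a)° x.
Proof. exact: interior_halfspaces. Qed.

Lemma unit_halfspaces_interior0 (I : finType) (a : I -> 'rV[R]_n) :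
  (unit_halfspaces a)° 0.
Proof. by apply: unit_halfspaces_interior => i; rewrite dotp0r. Qed.

Lemma unit_halfspaces_convex (I : finType) (a : I -> 'rV[R]_n) :
  convex_set (unit_halfspaces a).
Proof. exact: halfspaces_convex. Qed.

Lemma unit_halfspaces_interior_lt (I : finType) (a : I -> 'rV[R]_n) x i :
  (unit_halfspaces a)° x -> dotp (a i) x < 1.
Proof. by apply: interior_lt. Qed.

Lemma interior_affine_dim_ge A d :
  A° 0 -> (d <= n)%N -> affine_dim_ge A d.
Proof.
move=> A0 dn; pose V : 'M[R]_(d, n) := pid_mx d.
have [e e0 he] : exists2 e, 0 < e &
    forall t : R, 0 < t -> t <= e -> forall i, A (0 + t *: row i V).
  apply: all_small => i; have [e e0 he] := interior_segment (row i V) A0.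
  by exists e => // t t0 te; apply: he; rewrite gtr0_norm.
exists 0, (e *: V); split.
- exact: nbhs_singleton.
- by move=> i; rewrite linearZ /=; exact: he.
- by rewrite /row_free mxrank_scale_nz ?lt0r_neq0 // rank_pid_mx.
Qed.

Lemma interior_affine_dim A d : A° 0 -> affine_dim A d -> d = n.
Proof.
move=> A0 [[x [V [_ _ /eqP rV]]] nA]; apply/eqP; rewrite eqn_leq.
by rewrite -{1}rV rank_leq_col leqNgt; apply/negP => /(interior_affine_dim_ge A0).
Qed.

Lemma dotp1_neq0 c x : dotp c x = 1 -> c != 0.
Proof. by apply: contra_eq_neq => ->; rewrite dotpC dotp0r eq_sym oner_neq0. Qed.

Lemma mulmx_tr_eq0 d (V : 'M[R]_(d, n)) c :
  (forall i, dotp c (row i V) = 0) -> c *m V^T = 0.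
Proof.
move=> h; apply/rowP => i; rewrite [RHS]mxE -(h i) dotpE mxE.
by apply: eq_bigr => j _; rewrite !mxE.
Qed.

(** The functionals that vanish on [n - 1] independent vectors form a line. *)
Lemma functional_proportional d (V : 'M[R]_(d, n)) c c' x :
  n = d.+1 -> row_free V -> dotp c x = 1 ->
  (forall i, dotp c (row i V) = 0) -> (forall i, dotp c' (row i V) = 0) ->
  c' = dotp c' x *: c.
Proof.
move=> nd /eqP rV cx /mulmx_tr_eq0/eqP; rewrite -sub_kermx => cK.
move=> /mulmx_tr_eq0/eqP; rewrite -sub_kermx => c'K.
have c0 := dotp1_neq0 cx.
have : (kermx V^T <= c)%MS.
  rewrite -(mxrank_leqif_sup cK) mxrank_ker mxrank_tr rV rank_rV c0 /= nd.
  by rewrite subSnn.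
move=> /(submx_trans c'K)/sub_rVP[t ->].
by rewrite dotpZl cx mulr1.
Qed.

Lemma hyperplane_basis d c : n = d.+1 -> c != 0 ->
  exists V : 'M[R]_(d, n), row_free V /\ forall i, dotp c (row i V) = 0.
Proof.
move=> nd c0; have rK : \rank (kermx c^T) = d.
  by rewrite mxrank_ker mxrank_tr rank_rV c0 nd subn1.
suff key r (K : 'M[R]_(r, n)) : r = d -> row_free K -> (K <= kermx c^T)%MS ->
    exists V : 'M[R]_(d, n), row_free V /\ forall i, dotp c (row i V) = 0.
  by apply: key rK (row_base_free _) _; rewrite eq_row_base.
move=> rd; move: K; rewrite rd => K fK /sub_kermxP cK; exists K; split=> // i.
by rewrite dotpC /dotp -row_mul cK row0 mxE.
Qed.

Section Presentation.
Context {I : finType} (a : I -> 'rV[R]_n).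
Local Notation B := (unit_halfspaces a).

Lemma face_convex (P : set 'rV[R]_n) F : convex_set P -> face P F -> convex_set F.
Proof.
move=> /convexP cP [c [e [_ ->]]]; apply/convexP => x y t t0 t1 [Px cx] [Py cy].
by split; [exact: cP|rewrite !dotpr cx cy; lra].
Qed.

(** A relative interior point of a facet attains no other inequality: an
   inequality tight on the whole facet has the same normal vector, hence the
   same facet. *)
Lemma facet_presentation_strict :
  facet_presentation a B -> forall k, exists x, strict_at a k x.
Proof.
move=> [_ [aF a_inj _]] k.
have [face_k [d [[[x [V [Fx FV fV]] _] dimB]]]] := aF k Logic.I.
have nd := esym (interior_affine_dim (unit_halfspaces_interior0 a) dimB).
have cF := face_convex (unit_halfspaces_convex (a := a)) face_k.
have [z [Bz az] hz] := common_strict_point cF Fx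
  (fun y (Fy : B y /\ _) => Fy.1 : forall i, dotp (a i) y <= (fun=> 1) i).
exists z; split=> // i ik; case: (hz i) => // tight_i; case/eqP: ik.
have row0 j c : (forall y, B y /\ dotp (a k) y = 1 -> dotp c y = 1) ->
    dotp c (row j V) = 0.
  move=> hc; have := hc _ (FV j); rewrite dotpDr (hc _ Fx).
  by move/eqP; rewrite -subr_eq0 addrC addKr => /eqP.
have aik : a i = a k.
  rewrite [LHS](functional_proportional nd fV Fx.2).
  - by rewrite tight_i // scale1r.
  - by move=> j; apply: row0 => y [].
  - by move=> j; apply: row0.
by apply: a_inj; rewrite ?inE // aik.
Qed.

(** The only inequality tight at [x] is the [k]-th, so moving along its
   hyperplane stays in the polyhedron for a while. *)
Lemma strict_segment k x u : strict_at a k x -> dotp (a k) u = 0 ->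
  exists2 e, 0 < e & forall t, `|t| <= e -> B (x + t *: u).
Proof.
move=> [akx aix] aku; have [e e0 he] : exists2 e, 0 < e &
    forall r : R, 0 < r -> r <= e -> forall i t, `|t| <= r ->
    dotp (a i) (x + t *: u) <= 1.
  apply: all_small => i; have [->|ik] := eqVneq i k.
    by exists 1 => // r _ _ t _; rewrite !dotpr akx aku mulr0 addr0.
  have lt1 := aix i ik; set v := dotp (a i) u.
  have v1 : 0 < 1 + `|v| by rewrite ltr_pwDl.
  exists ((1 - dotp (a i) x) / (1 + `|v|)); first by rewrite divr_gt0 ?subr_gt0.
  move=> r r0; rewrite ler_pdivlMr // => h t tr; rewrite !dotpr -/v.
  by have := ler_norm (t * v); rewrite normrM; have := normr_ge0 v; nra.
by exists e => // t te i; exact: he te.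
Qed.

(** The facet contains [x] together with small displacements along a basis of
   the hyperplane orthogonal to [a k], and has no larger dimension since it lies
   in a translate of that hyperplane. *)
Lemma strict_facet k x : strict_at a k x ->
  facet B [set y | B y /\ dotp (a k) y = 1].
Proof.
move=> [akx aix]; split.
  by exists (a k), 1; split=> // y /(_ k).
have ak0 := dotp1_neq0 akx.
have [d nd] : exists d, n = d.+1.
  exists n.-1; rewrite prednK // lt0n; apply: contraNneq ak0 => n0.
  by apply/eqP/rowP => -[m lt_m]; exfalso; rewrite n0 in lt_m.
have [V [fV aV]] := hyperplane_basis nd ak0.
have [e e0 he] : exists2 e, 0 < e & forall t : R, 0 < t -> t <= e ->
    forall j, B (x + t *: row j V).
  apply: all_small => j; have [e e0 he] := strict_segment (conj akx aix) (aV j).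
  by exists e => // t t0 te; apply: he; rewrite gtr0_norm.
have Bx : B x by move=> i; have [->|/aix/ltW //] := eqVneq i k; rewrite akx.
exists d; split; last first.
  rewrite -nd; split.
    exact: interior_affine_dim_ge (unit_halfspaces_interior0 a) _.
  by move=> [y [W [_ _ /eqP rW]]]; have := rank_leq_col W; rewrite rW ltnn.
split.
  exists x, (e *: V); split=> //.
  - move=> j; rewrite linearZ /=; split; last by rewrite !dotpr akx aV mulr0 addr0.
    exact: he.
  - by rewrite /row_free mxrank_scale_nz ?lt0r_neq0.
rewrite -nd => -[y [W [[_ ay] hW]]]; rewrite row_free_unit => uW.
case/eqP: ak0; apply: (can_inj (mulmxK (_ : W^T \in unitmx))).
  by rewrite unitmx_tr.
rewrite mul0mx; apply: mulmx_tr_eq0 => j; have [_] := hW j.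
by rewrite dotpDr ay => /eqP; rewrite -subr_eq0 addrC addKr => /eqP.
Qed.

(** On a facet some inequality is tight throughout, since a relative interior
   point of the facet is not interior to the polyhedron; by dimension the
   facet is then the whole face that this inequality cuts out. *)
Lemma facet_tight F : facet B F ->
  exists k, F = [set x | B x /\ dotp (a k) x = 1].
Proof.
move=> [face_F [d [[[x [V [Fx FV fV]]] ngeF dimB]]]].
have nd := esym (interior_affine_dim (unit_halfspaces_interior0 a) dimB).
have cF := face_convex (unit_halfspaces_convex (a := a)) face_F.
move: face_F Fx FV cF ngeF => [c [e [Be ->]]] Fx FV cF ngeF.
have c0 : c != 0.
  apply/eqP => c0; apply: ngeF; have [Bx] := Fx; rewrite c0 dotpC dotp0r => e0.
  suff -> : [set x | B x /\ dotp 0 x = e] = B by case: dimB.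
  by rewrite -e0; apply/seteqP; split=> [y []|y By] //; split; rewrite // dotpC dotp0r.
have [z [Bz cz] hz] := common_strict_point cF Fx
  (fun y (Fy : B y /\ _) => Fy.1 : forall i, dotp (a i) y <= (fun=> 1) i).
have [k tight_k] : exists k, forall y, B y /\ dotp c y = e -> dotp (a k) y = 1.
  apply: contrapT => /forallNP nt; case/eqP: c0.
  apply: (interior_max_eq0 Be _ cz); apply: unit_halfspaces_interior => i.
  by case: (hz i) => // /nt.
exists k; have row0 j c' e' : (forall y, B y /\ dotp c y = e -> dotp c' y = e') ->
    dotp c' (row j V) = 0.
  move=> hc; have := hc _ (FV j); rewrite dotpDr (hc _ Fx).
  by move/eqP; rewrite -subr_eq0 addrC addKr => /eqP.
have ce : c = e *: a k.
  rewrite [LHS](functional_proportional nd fV (tight_k _ Fx)).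
  - by rewrite Fx.2.
  - by move=> j; exact: (row0 j (a k) 1).
  - by move=> j; apply: (row0 j c e) => y [].
have e0 : e != 0 by apply: contraNneq c0 => e0; rewrite ce e0 scale0r.
apply/seteqP; split=> y [By hy]; split=> //; first exact: tight_k.
by rewrite ce dotpZl hy mulr1.
Qed.

Lemma strict_facet_presentation :
  (forall k, exists x, strict_at a k x) -> facet_presentation a B.
Proof.
move=> h; split=> //; split.
- by move=> k _; have [x /strict_facet] := h k.
- move=> i k _ _ Fik; have [x [aix ajx]] := h i; apply/eqP/negP => /negP ik.
  have Bx : B x by move=> j; have [->|/ajx/ltW //] := eqVneq j i; rewrite aix.
  have : [set y | B y /\ dotp (a i) y = 1] x by [].
  by rewrite Fik => -[_ akx]; have := ajx k; rewrite eq_sym akx ltxx => /(_ ik).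
- by move=> F /facet_tight[k ->]; exists k.
Qed.

End Presentation.

End Facets.

(** * Coproducts of polyhedra *)

Section Prepolar.
Context {R : realType} {n : nat} {I : finType} (c : I -> 'rV[R]_n).
Implicit Types (x y u : 'rV[R]_n) (X : set 'rV[R]_n).
Local Notation C := (unit_halfspaces c).

(** Let [x0] be a relative interior point of the facet cut out by [c k]. Since
   [x0 + t *: c k] lies outside [C], some [x] in [X] has scalar product greater
   than [1] with it; this [x] is almost tight at [x0] and at most [1] on the
   facet around [x0], which forces it to tend to [c k] as [t] tends to [0]. *)
Lemma prepolar_normal X k x0 :
  strict_at c k x0 -> closed X -> polar X = C -> X (c k).
Proof.
move=> st clX pX.
have XC x y : X x -> C y -> dotp x y <= 1 by move=> Xx; rewrite -pX => /(_ x Xx).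
have [rho rho0 /(_ rho)] := interior_segment (c k) (unit_halfspaces_interior0 c).
rewrite gtr0_norm // add0r => /(_ (lexx _)) Crho.
have XM x : X x -> dotp x (c k) <= rho^-1.
  by move=> /XC/(_ Crho); rewrite dotpZr -ler_pdivlMl // mulr1.
have M0 : 0 < rho^-1 by rewrite invr_gt0.
move: (rho^-1) XM M0 => M XM M0 {rho rho0 Crho}.
have [ck1 _] := st; have ckk := dotp_gt0 (dotp1_neq0 ck1).
(* Basis vectors projected along [x0] to the hyperplane orthogonal to [c k]. *)
pose w j : 'rV[R]_n := delta_mx 0 j - c k 0 j *: x0.
have ckw j : dotp (c k) (w j) = 0.
  by rewrite /w !dotpr ck1 dotp_delta mulr1 subrr.
rewrite (closure_id X).1 // => N /nbhs_ballP[r /= r0 rN].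
have [d d0 hd] : exists2 d, 0 < d & forall t : R, 0 < t -> t <= d -> forall j x,
    X x -> 1 < dotp x (x0 + t *: c k) -> `|c k 0 j - x 0 j| < r.
  apply: all_small => j; have [e e0 he] := strict_segment st (ckw j).
  pose K := M / e + `|c k 0 j| * M.
  have K0 : 0 < 1 + K by rewrite ltr_wpDr // addr_ge0 ?mulr_ge0 ?invr_ge0 // ltW.
  exists (r / (1 + K)); first by rewrite divr_gt0.
  move=> t t0; rewrite ler_pdivlMr // => tK x Xx; rewrite !dotpr => x_t.
  have xw : x 0 j = dotp x (w j) + c k 0 j * dotp x x0.
    by rewrite /w !dotpr dotp_delta subrK.
  have xM := XM _ Xx.
  have x01 : dotp x x0 <= 1.
    by have := XC _ _ Xx (he 0 _); rewrite scale0r addr0; apply; rewrite normr0 ltW.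
  have xp : dotp x x0 + e * dotp x (w j) <= 1.
    by rewrite -!dotpr; apply: XC => //; apply: he; rewrite gtr0_norm.
  have xn : dotp x x0 - e * dotp x (w j) <= 1.
    by rewrite -!dotpr -scaleNr; apply: XC => //; apply: he; rewrite normrN gtr0_norm.
  have xwe : `|dotp x (w j)| * e <= t * M.
    have tM : t * dotp x (c k) <= t * M by rewrite ler_wpM2l // ltW.
    by case: (ger0P (dotp x (w j))) => _; lra.
  have xwle : `|dotp x (w j)| <= t * (M / e) by rewrite mulrA ler_pdivlMr.
  have -> : c k 0 j - x 0 j = c k 0 j * (1 - dotp x x0) - dotp x (w j).
    by rewrite xw; ring.
  apply: le_lt_trans (ler_normB _ _) _; rewrite normrM (ger0_norm (_ : 0 <= 1 - _)).
    have cM : `|c k 0 j| * (1 - dotp x x0) <= `|c k 0 j| * (t * M).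
      by apply: ler_wpM2l => //; nra.
    by rewrite /K in tK; nra.
  by lra.
have : ~ polar X (x0 + d *: c k).
  by rewrite pX => /(_ k); rewrite !dotpr ck1; nra.
move=> /existsNP[x /not_implyP[Xx /negP]]; rewrite -ltNge => xd.
exists x; split=> //; apply: rN; split=> // i j; rewrite ord1.
exact: hd (lexx _) _ _ Xx xd.
Qed.

(** The normals form a prepolar themselves, and every prepolar contains them. *)
Lemma smallest_prepolar_normals :
  (forall k, exists x, strict_at c k x) -> smallest_prepolar C = range c.
Proof.
move=> st; apply/seteqP; split=> [y|_ [k _ <-] X [[clX pX] _]]; last first.
  by have [x0 /prepolar_normal] := st k; exact.
apply; split=> //; split.
  apply: accessible_finite_set_closed.1; first exact: hausdorff_accessible.
  exact: finite_image.
apply/seteqP; split=> [z h i|z h _ [i _ <-]]; last exact: h.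
by apply: h; exists i.
Qed.

End Prepolar.

Lemma scale_unit_halfspaces {R : realType} {n} (I : finType)
    (a : I -> 'rV[R]_n) (t : R) : 0 < t ->
  scale_set t^-1 (unit_halfspaces a) = unit_halfspaces (fun i => t *: a i).
Proof.
move=> t0; have tn0 := lt0r_neq0 t0.
apply/seteqP; split=> [_ [x ax <-] i|x ax]; first by rewrite dotpZl dotpZr mulVKf.
exists (t *: x); last by rewrite scalerA mulVf // scale1r.
by move=> i; rewrite dotpZr -dotpZl.
Qed.

Lemma strict_at_scale {R : realType} {n} (I : finType)
    (a : I -> 'rV[R]_n) (t : R) k x : 0 < t ->
  strict_at a k x -> strict_at (fun i => t *: a i) k (t^-1 *: x).
Proof.
move=> /lt0r_neq0 t0 [akx aix].
by split=> [|i ik]; rewrite dotpZl dotpZr mulVKf // aix.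
Qed.

Section Coproduct.
Context {R : realType} {n1 n2 : nat} {I1 I2 : finType}.
Variables (a1 : I1 -> 'rV[R]_n1) (a2 : I2 -> 'rV[R]_n2) (mu : R).
Hypotheses (mu_gt0 : 0 < mu) (mu_lt1 : mu < 1).

Definition coproduct_normal (p : I1 * I2) : 'rV[R]_(n1 + n2) :=
  row_mx (mu *: a1 p.1) ((1 - mu) *: a2 p.2).

Lemma dotp_row_mx (c1 : 'rV[R]_n1) (c2 : 'rV[R]_n2) z :
  dotp (row_mx c1 c2) z = dotp c1 (lsubmx z) + dotp c2 (rsubmx z).
Proof. by rewrite /dotp -{1}[z]hsubmxK tr_row_mx mul_row_col mxE. Qed.

Lemma dotp_coproduct_normal p z : dotp (coproduct_normal p) z =
  mu * dotp (a1 p.1) (lsubmx z) + (1 - mu) * dotp (a2 p.2) (rsubmx z).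
Proof. by rewrite dotp_row_mx !dotpZl. Qed.

(** The value of the normal [(i, j)] is a convex combination of those of
   [a1 i] and [a2 j], both at most [1], and is [1] only if both are. *)
Lemma strict_at_coproduct k1 k2 z :
  strict_at a1 k1 (lsubmx z) -> strict_at a2 k2 (rsubmx z) ->
  strict_at coproduct_normal (k1, k2) z.
Proof.
have mu'_gt0 : 0 < 1 - mu by rewrite subr_gt0.
move=> [a1z1 lt1] [a2z1 lt2]; split=> [|[i j] ij]; rewrite dotp_coproduct_normal /=.
  by rewrite a1z1 a2z1; lra.
have le1 : dotp (a1 i) (lsubmx z) <= 1.
  by have [->|/lt1/ltW //] := eqVneq i k1; rewrite a1z1.
have le2 : dotp (a2 j) (rsubmx z) <= 1.
  by have [->|/lt2/ltW //] := eqVneq j k2; rewrite a2z1.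
have [ik|ik] := eqVneq i k1.
  have jk : j != k2 by apply: contra_neq ij => ->; rewrite ik.
  have : (1 - mu) * dotp (a2 j) (rsubmx z) < 1 - mu by rewrite gtr_pMr // lt2.
  by have : mu * dotp (a1 i) (lsubmx z) <= mu by [rewrite ger_pMr]; lra.
have : mu * dotp (a1 i) (lsubmx z) < mu by rewrite gtr_pMr // lt1.
by have : (1 - mu) * dotp (a2 j) (rsubmx z) <= 1 - mu by [rewrite ger_pMr]; lra.
Qed.

Lemma coproduct_halfspaces :
  (forall k, exists x, strict_at a1 k x) -> (forall k, exists x, strict_at a2 k x) ->
  coproduct (scale_set mu^-1 (unit_halfspaces a1))
    (scale_set (1 - mu)^-1 (unit_halfspaces a2)) = unit_halfspaces coproduct_normal.
Proof.
have mu'_gt0 : 0 < 1 - mu by rewrite subr_gt0.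
move=> st1 st2; rewrite /coproduct !scale_unit_halfspaces //.
rewrite !smallest_prepolar_normals; first last.
- by move=> k; have [x /(strict_at_scale mu_gt0)] := st1 k; eexists; eauto.
- by move=> k; have [x /(strict_at_scale mu'_gt0)] := st2 k; eexists; eauto.
apply/seteqP; split=> [z h [i j]|z h c [[i _ ic] [j _ jc]]].
  by apply: h; rewrite /prod_set /= row_mxKl row_mxKr; split; [exists i|exists j].
by rewrite -[c]hsubmxK -ic -jc; exact: (h (i, j)).
Qed.

End Coproduct.

(** * Sets free of points of [S] *)

Section SFree.
Context {R : realType} {n : nat} {I : finType} (a : I -> 'rV[R]_n).
Implicit Types (x y u : 'rV[R]_n) (S : set 'rV[R]_n).
Local Notation B := (unit_halfspaces a).

Lemma S_free_unit_halfspaces S :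
  S_free S B <-> forall s, S s -> exists i, 1 <= dotp (a i) s.
Proof.
split=> [[_ BS] s Ss|h].
  apply: contrapT => /forallNP lt1.
  suff : (B° `&` S) s by rewrite BS.
  split=> //; apply: unit_halfspaces_interior => i.
  by rewrite ltNge; apply/negP.
split; first exact: unit_halfspaces_convex.
apply/seteqP; split=> // s [Bs /h[i]]; rewrite leNgt => /negP; apply.
exact: unit_halfspaces_interior_lt.
Qed.

(** A larger convex set contains a point [p] beyond some facet; the point of
   [S] in the relative interior of that facet lies strictly between [p] and an
   interior point of [B], so it is interior to the larger set. *)
Lemma maximal_S_free_of_strict S :
  S_free S B -> (forall k, exists2 s, S s & strict_at a k s) ->
  maximal_S_free S B.
Proof.
move=> freeB st; split=> // B' [cB' B'S] BB'; apply/seteqP; split=> // p B'p k.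
rewrite leNgt; apply/negP => akp; have [s Ss [aks ais]] := st k.
have [e e0 he] : exists2 e, 0 < e & forall t : R, 0 < t -> t <= e ->
    forall i, dotp (a i) (s + t *: (s - p)) < 1.
  apply: all_small => i; have [->|ik] := eqVneq i k.
    by exists 1 => // t t0 _; rewrite !dotpr aks; nra.
  have lt1 := ais i ik; set v := dotp (a i) (s - p).
  have v1 : 0 < 1 + `|v| by rewrite ltr_pwDl.
  exists ((1 - dotp (a i) s) / (1 + `|v|)); first by rewrite divr_gt0 ?subr_gt0.
  move=> t t0; rewrite ler_pdivlMr // dotpDr dotpZr -/v => h.
  by have := ler_norm v; nra.
suff : (B'° `&` S) s by rewrite B'S.
(* The weight for which [s] is the combination of [p] and [s + e *: (s - p)]. *)
split=> //; pose l := e / (1 + e).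
have l0 : 0 < l by rewrite divr_gt0 ?addr_gt0.
have l1 : l < 1 by rewrite ltr_pdivrMr ?mul1r ?addr_gt0 // ltrDr.
have : \forall y \near s, B (y + e *: (y - p)).
  have h : (fun y => y + e *: (y - p)) @ s --> s + e *: (s - p).
    have hp : (fun y => y - p) @ s --> s - p.
      by apply: (@cvgB _ _ _ (nbhs s) _ id (cst p)); [exact: cvg_id|exact: cvg_cst].
    by apply: (@cvgD _ _ _ (nbhs s) _ id); [exact: cvg_id|exact: cvgZl_tmp].
  by apply: h; apply: unit_halfspaces_interior => i; exact: he.
apply: filterS => y By; have -> : y = l *: p + (1 - l) *: (y + e *: (y - p)).
  apply/rowP => j; rewrite !mxE /l; field.
  by rewrite lt0r_neq0 // addr_gt0.
by apply: (convexP _).1 => //; [exact: ltW|exact: ltW|exact: BB'].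
Qed.

End SFree.

Section ProductSets.
Context {R : realType} {n1 n2 : nat} {I1 I2 : finType}.
Variables (a1 : I1 -> 'rV[R]_n1) (a2 : I2 -> 'rV[R]_n2) (mu : R).
Variables (S1 : set 'rV[R]_n1) (S2 : set 'rV[R]_n2).
Hypotheses (mu_gt0 : 0 < mu) (mu_lt1 : mu < 1).
Local Notation c := (coproduct_normal a1 a2 mu).

(** Both components of a point of [prod_set S1 S2] attain or violate some
   inequality of their polyhedron, and the combination of these two inequalities
   excludes the point from the interior of the coproduct. *)
Lemma S_free_coproduct :
  S_free S1 (unit_halfspaces a1) -> S_free S2 (unit_halfspaces a2) ->
  S_free (prod_set S1 S2) (unit_halfspaces c).
Proof.
have mu'_gt0 : 0 < 1 - mu by rewrite subr_gt0.
move=> /S_free_unit_halfspaces free1 /S_free_unit_halfspaces free2.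
apply/S_free_unit_halfspaces => s [/free1[i a1s] /free2[j a2s]].
exists (i, j); rewrite dotp_coproduct_normal /= -[X in X <= _](subrK mu) addrC.
by rewrite lerD // ler_peMr // ltW.
Qed.

Lemma translation_vectors_prod w1 w2 :
  translation_vectors S1 w1 -> translation_vectors S2 w2 ->
  translation_vectors (prod_set S1 S2) (row_mx w1 w2).
Proof.
move=> t1 t2 s [S1s S2s] l; split; rewrite linearD linearZ /=.
  by rewrite row_mxKl; exact: t1.
by rewrite row_mxKr; exact: t2.
Qed.

(** The inequalities defining a lifting region of the coproduct are convex
   combinations of those of the two factors. *)
Lemma lifting_region_prod r1 r2 :
  lifting_region S1 a1 (unit_halfspaces a1) r1 ->
  lifting_region S2 a2 (unit_halfspaces a2) r2 ->
  lifting_region (prod_set S1 S2) c (unit_halfspaces c) (row_mx r1 r2).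
Proof.
have mu'_gt0 : 0 < 1 - mu by rewrite subr_gt0.
have comb (u v : R) : u <= 0 -> v <= 0 -> mu * u + (1 - mu) * v <= 0.
  by move=> u0 v0; rewrite -[0]addr0 lerD // pmulr_rle0.
move=> [s1 [B1s S1s] [k1 a1s h1]] [s2 [B2s S2s] [k2 a2s h2]].
exists (row_mx s1 s2).
  split; last by rewrite /prod_set /= row_mxKl row_mxKr.
  move=> [i j]; rewrite dotp_coproduct_normal row_mxKl row_mxKr /=.
  rewrite -[X in _ <= X](subrK mu) addrC.
  by rewrite lerD // ger_pMr.
exists (k1, k2).
  by rewrite dotp_coproduct_normal row_mxKl row_mxKr a1s a2s /=; ring.
move=> [i j]; have [h1i h1i'] := h1 i; have [h2j h2j'] := h2 j.
rewrite !dotpBl !dotp_coproduct_normal opp_row_mx add_row_mx.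
rewrite !row_mxKl !row_mxKr /=.
split.
  apply: le_trans (comb _ _ h1i h2j); rewrite !dotpBl le_eqVlt; apply/orP; left.
  by apply/eqP; ring.
apply: le_trans (comb _ _ h1i' h2j'); rewrite !dotpBl le_eqVlt; apply/orP; left.
by apply/eqP; ring.
Qed.

End ProductSets.

Lemma facet_presentationE {R : realType} {n} (I : finType) (a : I -> 'rV[R]_n) B :
  facet_presentation a B ->
  B = unit_halfspaces a /\ forall k, exists x, strict_at a k x.
Proof.
move=> pB; have [eB _] := pB; split=> //.
by apply: facet_presentation_strict; rewrite -[unit_halfspaces a]eB.
Qed.

Lemma coproduct_presentation {R : realType} {n1 n2} (I1 I2 : finType)
    (a1 : I1 -> 'rV[R]_n1) (a2 : I2 -> 'rV[R]_n2) B1 B2 (mu : R) :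
  0 < mu -> mu < 1 -> facet_presentation a1 B1 -> facet_presentation a2 B2 ->
  let B := coproduct (scale_set mu^-1 B1) (scale_set (1 - mu)^-1 B2) in
  B = unit_halfspaces (coproduct_normal a1 a2 mu) /\
  facet_presentation (coproduct_normal a1 a2 mu) B.
Proof.
move=> mu0 mu1 /facet_presentationE[-> st1] /facet_presentationE[-> st2] /=.
rewrite coproduct_halfspaces //; split=> //; apply: strict_facet_presentation.
move=> [k1 k2]; have [x1 s1] := st1 k1; have [x2 s2] := st2 k2.
by exists (row_mx x1 x2); apply: strict_at_coproduct; rewrite ?row_mxKl ?row_mxKr.
Qed.

Lemma covering_property_coproduct {R : realType} {n1 n2}
    (B1 S1 : set 'rV[R]_n1) (B2 S2 : set 'rV[R]_n2) (mu : R) :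
  0 < mu -> mu < 1 -> covering_property S1 B1 -> covering_property S2 B2 ->
  covering_property (prod_set S1 S2)
    (coproduct (scale_set mu^-1 B1) (scale_set (1 - mu)^-1 B2)).
Proof.
move=> mu0 mu1 [I1 [a1 [p1 cov1]]] [I2 [a2 [p2 cov2]]].
have [eB pB] := coproduct_presentation mu0 mu1 p1 p2.
exists (I1 * I2)%type, (coproduct_normal a1 a2 mu); split=> //.
apply/seteqP; split=> // x _; rewrite eB.
have [r1 R1 [w1 W1 x1]] : [set r + w | r in lifting_region S1 a1 B1
  & w in translation_vectors S1] (lsubmx x) by rewrite cov1.
have [r2 R2 [w2 W2 x2]] : [set r + w | r in lifting_region S2 a2 B2
  & w in translation_vectors S2] (rsubmx x) by rewrite cov2.
have [eB1 _] := facet_presentationE p1; have [eB2 _] := facet_presentationE p2.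
rewrite eB1 in R1; rewrite eB2 in R2.
exists (row_mx r1 r2); first exact: lifting_region_prod.
exists (row_mx w1 w2); first exact: translation_vectors_prod.
by rewrite add_row_mx x1 x2 hsubmxK.
Qed.

(** * Ultrafilter limits of bounded sequences *)

Section UltraLimits.
Context {R : realType} (U : set_system nat) {UU : UltraFilter U}.
Implicit Types (f : nat -> R).

(** Convergence along [U], spelled out because only the sets in [U] on which
   [f] is close to [l] are ever used. *)
Definition tends_to f (l : R) : Prop :=
  forall e, 0 < e -> U [set m | `|f m - l| < e].

(** A segment is compact, so [f] has a cluster point along [U], and a cluster
   point of an ultrafilter is a limit. *)
Lemma ultra_tends_to f (K M : R) :
  U [set m | K <= f m] -> (forall m, f m <= M) -> exists l, tends_to f l.
Proof.
move=> UK fM; have UKM : (f @ U) `[K, M]%classic.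
  by apply: (@filterS _ U _ _ _ _ UK) => m /= Km; rewrite in_itv /= Km fM.
have [l [_ clu]] := segment_compact (fmap_proper_filter f _) UKM.
exists l => e e0.
have [//|Uc] := in_ultra_setVsetC [set m | `|f m - l| < e] UU.
have /clu/(_ (nbhsx_ballx l e e0)) : (f @ U) [set r | ~ `|r - l| < e] by [].
by move=> [r [/= far]]; rewrite /ball /= distrC => /far.
Qed.

Lemma ultra_bounded_above f M : (forall m, f m <= M) ->
  (forall K, U [set m | f m < K]) \/ exists l, tends_to f l.
Proof.
move=> fM; have [?|/existsNP[K nK]] := pselect (forall K, U [set m | f m < K]).
  by left.
right; apply: (ultra_tends_to (K := K)) fM.
have [//|] := in_ultra_setVsetC [set m | f m < K] UU.
by apply: filterS => m /= /negP; rewrite -leNgt.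
Qed.

Lemma tends_to_diff f l e : tends_to f l -> 0 < e ->
  U [set m | U [set m' | `|f m' - f m| < e]].
Proof.
move=> fl e0; have e20 : 0 < e / 2 by lra.
apply: filterS (fl _ e20) => m /= fm; apply: filterS (fl _ e20) => m' /= fm'.
have -> : f m' - f m = (f m' - l) - (f m - l) by ring.
by apply: le_lt_trans (ler_normB _ _) _; lra.
Qed.

(** Along [U] the sequence either converges or tends to [-oo]. *)
Lemma ultra_small_increase f M e : (forall m, f m <= M) -> 0 < e ->
  U [set m | U [set m' | f m' - f m < e]].
Proof.
move=> /ultra_bounded_above[dive e0|[l fl e0]].
  apply: filterE => m; apply: filterS (dive (f m + e)) => m' /=.
  by rewrite ltrBlDl.
apply: filterS (tends_to_diff fl e0) => m; apply: filterS => m' /=.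
exact/le_lt_trans/ler_norm.
Qed.

Lemma ultra_pick (A A' : set nat) : U A -> U A' -> exists2 m, A m & A' m.
Proof.
by move=> UA UA'; have [m [Am A'm]] := filter_ex (filterI UA UA'); exists m.
Qed.

Lemma ultra_forall (J : finType) (P : J -> nat -> Prop) :
  (forall j, U (P j)) -> U [set m | forall j, P j m].
Proof. by move=> h; apply: (@filter_forall _ J P U). Qed.

Lemma ultra_forall2 (J : finType) (P : J -> nat -> nat -> Prop) :
  (forall j, U [set m | U [set m' | P j m m']]) ->
  U [set m | U [set m' | forall j, P j m m']].
Proof.
move=> /(ultra_forall (P := fun j m => U [set m' | P j m m'])).
by apply: filterS => m; exact: ultra_forall.
Qed.

End UltraLimits.

Lemma ultra_at_infinity : exists2 U : set_system nat, UltraFilter U &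
  forall (R : realType) (e : R), 0 < e -> U [set m | m.+1%:R^-1 < e].
Proof.
have [U [UU le_U]] := @ultraFilterLemma nat \oo _.
by exists U => // R e e0; apply: le_U; exact: (near_infty_natSinv_lt (PosNum e0)).
Qed.

(** * Points of [S] on the facets of a maximal [S]-free polyhedron *)

Section Attained.
Context {R : realType} {n : nat}.
Implicit Types (x y u w : 'rV[R]_n) (S : set 'rV[R]_n).

Definition translates_into S w : Prop := forall s, S s -> S (s + w).

(** A well-quasi-ordering property: order [S] by letting [s] precede [s'] when
   [s' - s] translates [S] into itself. Stated along an ultrafilter, it yields
   pairs that can be combined with finitely many limits of the sequence; this
   replaces the extraction of subsequences. *)
Definition translation_wqo S : Prop :=
  forall (U : set_system nat) (s : nat -> 'rV[R]_n), UltraFilter U ->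
  (forall m, S (s m)) -> U [set m | U [set m' | translates_into S (s m' - s m)]].

Lemma translates_into_muln S w k :
  translates_into S w -> translates_into S (w *+ k).
Proof.
move=> Sw; elim: k => [|k IH] s Ss; first by rewrite mulr0n addr0.
by rewrite mulrSr addrA; apply/Sw/IH.
Qed.

Section Polyhedron.
Context {I : finType} (a : I -> 'rV[R]_n) (S : set 'rV[R]_n).
Local Notation B := (unit_halfspaces a).
Hypothesis maxB : maximal_S_free S B.
Hypothesis strictB : forall k, exists x, strict_at a k x.
Hypothesis wqoS : translation_wqo S.

Lemma maximal_eq B' : convex_set B' -> B `<=` B' ->
  (forall s, B'° s -> S s -> False) -> B' = B.
Proof.
move=> cB' BB' free; apply: maxB.2 => //; split=> //.
by apply/seteqP; split=> // s [/free h /h].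
Qed.

Lemma no_interior_point s : S s -> (forall i, dotp (a i) s < 1) -> False.
Proof.
move=> Ss lt1; have := maxB.1; rewrite S_free_unit_halfspaces => /(_ s Ss)[i].
by rewrite leNgt lt1.
Qed.

Lemma point_beyond_facet k (e : R) : 0 < e -> exists y,
  [/\ 1 < dotp (a k) y, dotp (a k) y <= 1 + e &
      forall i, i != k -> dotp (a i) y <= 1].
Proof.
move=> e0; have [x [akx aix]] := strictB k.
have [d d0 hd] : exists2 d, 0 < d & forall t : R, 0 < t -> t <= d ->
    forall i, i != k -> dotp (a i) (x + t *: x) <= 1.
  apply: all_small => i; have [->|ik] := eqVneq i k; first by exists 1.
  have lt1 := aix i ik; exists (1 - dotp (a i) x); first by rewrite subr_gt0.
  by move=> t t0 td _; rewrite !dotpr; nra.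
pose t := Num.min d e; have t0 : 0 < t by rewrite lt_min d0.
exists (x + t *: x); rewrite !dotpr akx mulr1 ltrDl lerD2l; split=> //.
  by rewrite ge_min lexx orbT.
by move=> i ik; apply: hd => //; rewrite ge_min lexx.
Qed.

(** Relaxing the [k]-th inequality gives a strictly larger convex set, whose
   interior must contain a point of [S] by maximality; as [B] is [S]-free, that
   point lies in the thin slab that was added. *)
Lemma point_near_facet k (e : R) : 0 < e -> exists s,
  [/\ S s, 1 <= dotp (a k) s, dotp (a k) s < 1 + e &
      forall i, i != k -> dotp (a i) s < 1].
Proof.
move=> e0; apply: contrapT => /forallNP none.
pose b i := if i == k then 1 + e else 1 : R.
have b1 i : 1 <= b i by rewrite /b; case: ifP => // _; lra.
have [y [lt_y y_le hy]] := point_beyond_facet k e0.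
suff eB : [set x | forall i, dotp (a i) x <= b i] = B.
  suff : B y by move=> /(_ k); rewrite leNgt lt_y.
  rewrite -eB => i; rewrite /b; case: ifP => [/eqP->|/negbT/hy] //.
apply: maximal_eq => [|x Bx i|s intB' Ss].
- exact: halfspaces_convex.
- exact: le_trans (Bx i) (b1 i).
have lt_b i : dotp (a i) s < b i.
  by apply: (interior_lt _ _ intB') => [|x /(_ i)//]; exact: lt_le_trans (b1 i).
case: (none s); split=> //.
- rewrite leNgt; apply/negP => lt1; apply: no_interior_point Ss _ => i.
  by have := lt_b i; rewrite /b; case: eqVneq => [->|].
- by have := lt_b k; rewrite /b eqxx.
- by move=> i ik; have := lt_b i; rewrite /b (negbTE ik).
Qed.

(** If some [a i] tended to [-oo] along [s], the differences of [s] would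
   decrease these functionals without bound and increase the others
   arbitrarily little, so the inequalities [i] could be dropped. *)
Lemma functionals_converge (U : set_system nat) (UU : UltraFilter U)
    (s : nat -> 'rV[R]_n) (M : R) :
  (forall m, S (s m)) -> (forall i m, dotp (a i) (s m) <= M) ->
  forall i, exists l, tends_to U (fun m => dotp (a i) (s m)) l.
Proof.
move=> Ss sM j; apply: contrapT => nj.
pose J i := ~ exists l, tends_to U (fun m => dotp (a i) (s m)) l.
have JK i K : J i -> U [set m | dotp (a i) (s m) < K].
  by move=> Ji; have [|/Ji] := ultra_bounded_above (sM i).
have eB : [set x | forall i, ~ J i -> dotp (a i) x <= 1] = B.
  apply: maximal_eq => [|x Bx i _|z intz Sz]; last 1 first.
  - have [d d0 hd] : exists2 d, 0 < d & forall t : R, 0 < t -> t <= d ->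
        forall i, ~ J i -> dotp (a i) z + t < 1.
      apply: all_small => i; have [Ji|nJi] := pselect (J i); first by exists 1.
      have : dotp (a i) z < 1 by apply: interior_lt intz => // x; exact.
      by exists ((1 - dotp (a i) z) / 2) => [|t t0 td _]; lra.
    have : U [set m | U [set m' | forall i,
        dotp (a i) (s m' - s m) < if asbool (J i) then 1 - dotp (a i) z else d]].
      apply: (@ultra_forall2 U UU I (fun i m m' =>
        dotp (a i) (s m' - s m) < if asbool (J i) then 1 - dotp (a i) z else d)).
      move=> i; case: asboolP => [Ji|nJi].
        apply: filterE => m; have := JK i (dotp (a i) (s m) + 1 - dotp (a i) z) Ji.
        by apply: filterS => m' /=; rewrite dotpBr; lra.
      apply: filterS (ultra_small_increase (sM i) d0) => m.
      by apply: filterS => m' /=; rewrite dotpBr.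
    move=> /(ultra_pick (wqoS UU Ss))[m /= U1 U2].
    have [m' /= step lt_d] := ultra_pick U1 U2.
    apply: no_interior_point (step _ Sz) _ => i; rewrite dotpDr.
    have := lt_d i; case: asboolP => [_|nJi]; first by lra.
    by have := hd d d0 (lexx d) i nJi; lra.
  - apply/convexP => x y t t0 t1 hx hy i nJi; rewrite !dotpr.
    by have := hx i nJi; have := hy i nJi; nra.
  - exact: Bx.
have [y [lt_y _ hy]] := point_beyond_facet j ltr01.
suff : B y by move=> /(_ j); rewrite leNgt lt_y.
by rewrite -eB => i nJi; apply: hy; apply: contra_notN nJi => /eqP ->.
Qed.

(** Translations of [S] have arbitrarily short vectors of values under [a] in
   nearly the direction of [v]. The error is relative to the length [t], so
   that multiples of [w] still follow the ray of [v] closely. *)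
Definition limit_direction (v : I -> R) : Prop :=
  forall e, 0 < e -> exists w t, [/\ translates_into S w, 0 < t, t < e &
    forall i, `|dotp (a i) w - t * v i| <= e * t].

Lemma limit_ray v t (e : R) : limit_direction v -> 0 <= t -> 0 < e ->
  exists2 w, translates_into S w & forall i, `|dotp (a i) w - t * v i| <= e.
Proof.
move=> lv t0 e0.
have [d d0 hd] : exists2 d, 0 < d & forall r : R, 0 < r -> r <= d ->
    forall i, r * (t + `|v i|) <= e.
  apply: all_small => i; have v0 : 0 < 1 + (t + `|v i|) by rewrite ltr_pwDl ?addr_ge0.
  exists (e / (1 + (t + `|v i|))); first by rewrite divr_gt0.
  by move=> r r0; rewrite ler_pdivlMr // mulrDr mulr1; lra.
have [w [r [Sw r0 rd hw]]] := lv d d0; pose N := Num.truncn (t / r).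
have /andP[Nle ltN] : N%:R <= t / r < N.+1%:R.
  by apply: truncn_itv; rewrite divr_ge0 // ltW.
rewrite ler_pdivlMr // in Nle; rewrite ltr_pdivrMr // -natr1 mulrDl mul1r in ltN.
exists (w *+ N); first exact: translates_into_muln.
move=> i; rewrite dotpMn -mulr_natl.
have -> : N%:R * dotp (a i) w - t * v i =
  N%:R * (dotp (a i) w - r * v i) - (t - N%:R * r) * v i by ring.
apply: le_trans (hd d d0 (lexx d) i); apply: le_trans (ler_normB _ _) _.
rewrite !normrM mulrDr lerD //.
  rewrite ger0_norm // (le_trans (ler_wpM2l _ (hw i))) // mulrCA.
  by rewrite ler_wpM2l // ltW.
by rewrite ler_wpM2r // ger0_norm; lra.
Qed.

(** Points of [S] can be translated almost along the ray of [v]. Hence the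
   convex set of all points that a displacement of their values along this ray
   brings into [B] is [S]-free as well, and equals [B] by maximality. It
   contains the opposites of translations that follow the ray, so a negative
   coordinate of [v] would make the values of [a i] unbounded on [B]. *)
Lemma limit_direction_ge0 v : limit_direction v -> forall i, 0 <= v i.
Proof.
move=> lv i; rewrite leNgt; apply/negP => vi.
have eB : [set x | exists2 t, 0 <= t & forall i, dotp (a i) x + t * v i <= 1] = B.
  apply: maximal_eq => [|x Bx|s ints Ss].
  - apply/convexP => x y t t0 t1 [p p0 hp] [q q0 hq].
    exists (t * p + (1 - t) * q) => [|j].
      by rewrite addr_ge0 // mulr_ge0 // subr_ge0.
    by rewrite !dotpr; have := hp j; have := hq j; nra.
  - by exists 0 => // j; rewrite mul0r addr0.
  have [d d0 /(_ d)] := interior_segment s ints.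
  rewrite gtr0_norm // => /(_ (lexx _))[t t0 ht].
  have d1 : 0 < 1 + d by rewrite addr_gt0.
  have e0 : 0 < d / (1 + d) / 2 by rewrite !divr_gt0.
  have [w Sw hw] := limit_ray lv (divr_ge0 t0 (ltW d1)) e0.
  apply: no_interior_point (Sw _ Ss) _ => j; rewrite dotpDr.
  have := hw j; rewrite ler_norml => /andP[_].
  have : dotp (a j) s + t / (1 + d) * v j <= 1 - d / (1 + d).
    have -> : 1 - d / (1 + d) = (1 + d)^-1 by field; exact: lt0r_neq0.
    rewrite -(ler_pM2r d1) mulVf ?lt0r_neq0 //; have := ht j; rewrite !dotpr.
    apply: le_trans; rewrite le_eqVlt; apply/orP; left; apply/eqP.
    by field; exact: lt0r_neq0.
  by lra.
(* At this parameter the ray has [i]-th value [-3], so a translation whose values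
   differ from it by at most [1] has [i]-th value at most [-2]. *)
have t0 : 0 <= - 3 / v i by rewrite mulNr oppr_ge0 pmulr_rle0 // invr_le0 ltW.
have [w Sw hw] := limit_ray lv t0 (ltr01 : 0 < 1 :> R).
have : B (- w).
  rewrite -eB; exists (- 3 / v i) => // j; rewrite dotpNr.
  by have := hw j; rewrite ler_norml => /andP[]; lra.
move=> /(_ i); rewrite dotpNr; have := hw i.
by rewrite divfK ?lt_eqF // ler_norml => /andP[_]; lra.
Qed.

(** Translations of [S] need not be invertible. But if [w p] and [w q] follow
   the ray of [v] and [w q] is much shorter than [w p], then [w q - w p] nearly
   follows the opposite ray, and the well-quasi-ordering makes it a translation
   for suitable [p] and [q]. *)
Lemma limit_direction_opp v s0 : S s0 -> limit_direction v ->
  limit_direction (fun i => - v i).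
Proof.
move=> Ss0 lv e e0; have [U UU Uinf] := ultra_at_infinity.
have inv0 p : 0 < p.+1%:R^-1 :> R by rewrite invr_gt0.
have [w hw] := choice (fun p => lv _ (inv0 p)); have [t ht] := choice hw.
have Sw p : S (s0 + w p) by have [+ _ _ _] := ht p; apply.
have e20 : 0 < e / 2 by lra.
have [p /= U1 pe] := ultra_pick (wqoS UU Sw) (Uinf R _ e20).
have [_ tp0 tp hp] := ht p.
have [d d0 hd] : exists2 d, 0 < d & forall r : R, 0 < r -> r <= d ->
    forall i, r * (`|v i| + 1) <= e / 2 * t p.
  apply: all_small => i; have v0 : 0 < `|v i| + 1 by rewrite ltr_wpDl.
  exists (e / 2 * t p / (`|v i| + 1)); first by rewrite divr_gt0 // mulr_gt0.
  by move=> r _; rewrite ler_pdivlMr.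
have [q /= step qd] := ultra_pick U1 (Uinf R _ d0).
have [_ tq0 tq hq] := ht q.
exists (w q - w p), (t p); split=> //; last 2 first.
- by apply: lt_trans tp _; apply: lt_trans pe _; lra.
- move=> i; rewrite dotpBr.
  have -> : dotp (a i) (w q) - dotp (a i) (w p) - t p * - v i =
    (dotp (a i) (w q) - t q * v i) + t q * v i - (dotp (a i) (w p) - t p * v i) by ring.
  apply: le_trans (ler_normB _ _) _.
  have hp' : `|dotp (a i) (w p) - t p * v i| <= e / 2 * t p.
    by apply: le_trans (hp i) _; rewrite ler_wpM2r // ltW.
  have hq' : `|dotp (a i) (w q) - t q * v i| <= q.+1%:R^-1.
    apply: le_trans (hq i) _; rewrite ger_pMr // (le_trans (ltW tq)) //.
    by rewrite invf_le1 ?ltr0n // ler1n.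
  have hv : `|t q * v i| <= q.+1%:R^-1 * `|v i|.
    by rewrite normrM (gtr0_norm tq0) ler_wpM2r // ltW.
  have := hd _ (inv0 q) (ltW qd) i; rewrite mulrDr mulr1 => hq''.
  apply: le_trans (lerD (le_trans (ler_normD _ _) (lerD hq' hv)) hp') _.
  by move: (q.+1%:R^-1) hq'' => z hq''; lra.
by move: step; rewrite opprD addrACA subrr add0r.
Qed.

(** Compactness: normalize the vectors of values and take their limit. *)
Lemma limit_direction_exists :
  (forall e : R, 0 < e -> exists w, [/\ translates_into S w,
     forall i, `|dotp (a i) w| < e & exists i, dotp (a i) w != 0]) ->
  exists2 v, limit_direction v & exists i, v i != 0.
Proof.
move=> small; have [U UU Uinf] := ultra_at_infinity.
have inv0 p : 0 < p.+1%:R^-1 :> R by rewrite invr_gt0.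
have [w hw] := choice (fun p => small _ (inv0 p)).
pose N p := \sum_i `|dotp (a i) (w p)|.
have le_N i p : `|dotp (a i) (w p)| <= N p.
  by rewrite /N (bigD1 i) //= lerDl sumr_ge0.
have N0 p : 0 < N p.
  by have [_ _ [i wi]] := hw p; apply: lt_le_trans (le_N i p); rewrite normr_gt0.
have ratio i p : `|dotp (a i) (w p) / N p| <= 1.
  by rewrite normrM normfV (gtr0_norm (N0 p)) ler_pdivrMr // mul1r.
have /choice[v hv] :
    forall i, exists l, tends_to U (fun p => dotp (a i) (w p) / N p) l.
  move=> i; apply: (@ultra_tends_to _ U UU _ (- 1) 1) => [|p].
    by apply: filterE => p /=; have := ratio i p; rewrite ler_norml => /andP[].
  by have := ratio i p; rewrite ler_norml => /andP[].
have close e : 0 < e -> U [set p | forall i, `|dotp (a i) (w p) / N p - v i| < e].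
  move=> e0; apply: (@ultra_forall U UU I
    (fun i p => `|dotp (a i) (w p) / N p - v i| < e)) => i.
  exact: hv.
exists v => [e e0|].
  have c0 : 0 < e / #|I|.+1%:R by rewrite divr_gt0.
  have [p /= pv pe] := ultra_pick (close e e0) (Uinf R _ c0).
  have [Sw wp _] := hw p; exists (w p), (N p); split=> //.
    apply: (@le_lt_trans _ _ (\sum_(i in I) p.+1%:R^-1)).
      by apply: ler_sum => i _; exact/ltW.
    rewrite sumr_const -[_ *+ #|_|]mulr_natr.
    apply: (@le_lt_trans _ _ (p.+1%:R^-1 * #|I|.+1%:R)).
      by rewrite ler_wpM2l ?(ltW (inv0 p)) // ler_nat.
    by rewrite -ltr_pdivlMr.
  move=> i; rewrite -[X in `|X - _|](divfK (lt0r_neq0 (N0 p))) (mulrC (N p)) -mulrBl.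
  by rewrite normrM (gtr0_norm (N0 p)) ler_wpM2r ?ltW.
(* If [v] vanished, all the normalized values would be too small to add up
   to [1] in absolute value. *)
apply: contrapT => /forallNP v0.
have c0 : 0 < (#|I|.+1%:R : R)^-1 by rewrite invr_gt0.
have [p /= pv _] := ultra_pick (close _ c0) (close _ c0).
have : \sum_i `|dotp (a i) (w p) / N p| = 1.
  rewrite -(divff (lt0r_neq0 (N0 p))) {2}/N mulr_suml; apply: eq_bigr => i _.
  by rewrite normrM normfV (gtr0_norm (N0 p)).
have : \sum_i `|dotp (a i) (w p) / N p| <= \sum_(i in I) #|I|.+1%:R^-1.
  apply: ler_sum => i _; have := pv i; have /negP/negPn/eqP-> := v0 i.
  by rewrite subr0 => /ltW.
move=> + eq1; rewrite eq1 sumr_const -[_ *+ #|_|]mulr_natr ler_pdivlMl // mulr1 ler_nat.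
by rewrite ltnn.
Qed.

(** Otherwise relaxing the [k]-th inequality less and less yields points of [S]
   with values under [a k] decreasing to [1] without reaching it. All the
   functionals converge along them, so some differences are translations of [S]
   on which the [a i] are small without all vanishing. Both [v] and [- v] are
   then limit directions for some nonzero [v], contradicting
   [limit_direction_ge0]. *)
Lemma facet_attained k : exists2 s, S s & strict_at a k s.
Proof.
apply: contrapT => none; have [U UU Uinf] := ultra_at_infinity.
have inv0 p : 0 < p.+1%:R^-1 :> R by rewrite invr_gt0.
have [s hs] := choice (fun p => point_near_facet k (inv0 p)).
have Ss p : S (s p) by have [] := hs p.
have gt1 p : 1 < dotp (a k) (s p).
  have [_ + _ lt1] := hs p; rewrite le_eqVlt => /predU1P[eq1|//].
  by case: none; exists (s p).
have sM i p : dotp (a i) (s p) <= 2.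
  have [_ _ lt_k lt1] := hs p; have [->|/lt1] := eqVneq i k; last by lra.
  have : (p.+1%:R^-1 : R) <= 1 by rewrite invf_le1 ?ltr0n // ler1n.
  by move: (p.+1%:R^-1) lt_k => z; lra.
have conv := functionals_converge UU Ss sM.
have [e e0|v lv [i vi]] := limit_direction_exists.
  have : U [set m | U [set m' |
      forall i, `|dotp (a i) (s m') - dotp (a i) (s m)| < e]].
    apply: (@ultra_forall2 U UU I (fun i m m' =>
      `|dotp (a i) (s m') - dotp (a i) (s m)| < e)) => i.
    by have [l hl] := conv i; exact: tends_to_diff hl e0.
  move=> /(ultra_pick (wqoS UU Ss))[m /= U1 U2].
  have d0 : 0 < dotp (a k) (s m) - 1 by rewrite subr_gt0.
  have [m' /= [step small] lt_m] := ultra_pick (filterI U1 U2) (Uinf R _ d0).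
  exists (s m' - s m); split=> // [i|]; first by rewrite dotpBr.
  exists k; rewrite dotpBr lt_eqF // subr_lt0.
  have [_ _ + _] := hs m'; move: (m'.+1%:R^-1) lt_m => z; lra.
have vi0 := limit_direction_ge0 lv i.
have := limit_direction_ge0 (limit_direction_opp (Ss 0%N) lv) i.
by rewrite oppr_ge0 => vi1; case/eqP: vi; apply/eqP; rewrite eq_le vi1.
Qed.

End Polyhedron.
End Attained.

(** * Polyhedrally truncated affine lattices *)

Section Lattice.
Context {R : realType} {n : nat} (L : set 'rV[R]_n) (latL : is_lattice L).
Implicit Types (c u v w z : 'rV[R]_n).

Lemma latticeB u v : L u -> L v -> L (u - v).
Proof.
have [V [_ ->]] := latL; move=> [p ->] [q ->]; exists (fun i => p i - q i).
by rewrite -sumrB; apply: eq_bigr => i _; rewrite rmorphB scalerBl.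
Qed.

Lemma lattice0 : L 0.
Proof.
have [V [_ ->]] := latL; exists (fun=> 0).
by rewrite big1 // => i _; rewrite scale0r.
Qed.

Lemma latticeD u v : L u -> L v -> L (u + v).
Proof.
move=> Lu Lv; rewrite -[v]opprK -[- v]sub0r.
by do 2!apply: latticeB => //; exact: lattice0.
Qed.

Lemma lattice_mulz u (k : int) : L u -> L (k%:~R *: u).
Proof.
have [V [_ ->]] := latL; move=> [p ->]; exists (fun i => k * p i).
by rewrite scaler_sumr; apply: eq_bigr => i _; rewrite scalerA -rmorphM.
Qed.

Definition coord_bounded u (C : R) : Prop := forall j, `|u 0 j| <= C.

Lemma coord_bounded_ex u : exists C, coord_bounded u C.
Proof.
by exists (\sum_j `|u 0 j|) => j; rewrite (bigD1 j) //= lerDl sumr_ge0.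
Qed.

Lemma coord_boundedD u v C D :
  coord_bounded u C -> coord_bounded v D -> coord_bounded (u + v) (C + D).
Proof.
by move=> uC vD j; rewrite mxE; apply: le_trans (ler_normD _ _) _; rewrite lerD.
Qed.

(** A bounded set contains finitely many lattice points: their coefficients in
   the basis of the lattice are integers bounded by some [K]. *)
Lemma lattice_bounded_discrete c C : exists2 eta, 0 < eta & forall v, L v ->
  coord_bounded v C -> `|dotp c v| < eta -> dotp c v = 0.
Proof.
have [V [fV eL]] := latL; have uV : V \in unitmx by rewrite -row_free_unit.
pose K0 := \sum_i \sum_j (`|C| * `|invmx V j i|).
have [K KK0] : exists K : nat, K0 <= K%:R.
  by exists (Num.truncn K0).+1; apply/ltW/truncnS_gt.
(* Shifting by [K] indexes the coefficients in [-K .. K] by an ordinal. *)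
pose pt (f : {ffun 'I_n -> 'I_(K + K).+1}) : 'rV[R]_n :=
  \sum_i ((f i : nat)%:Z - K%:Z)%:~R *: row i V.
have [eta eta0 heta] : exists2 d, 0 < d & forall t : R, 0 < t -> t <= d ->
    forall f, `|dotp c (pt f)| < t -> dotp c (pt f) = 0.
  apply: all_small => f; have [->|nz] := eqVneq (dotp c (pt f)) 0; first by exists 1.
  exists `|dotp c (pt f)|; first by rewrite normr_gt0.
  by move=> t _ /[swap] /lt_le_trans/[apply]; rewrite ltxx.
exists eta => // v; rewrite eL => -[z ev] vC.
have zK i : `|(z i)%:~R : R| <= K%:R.
  have -> : (z i)%:~R = (v *m invmx V) 0 i.
    suff -> : v = (\row_i (z i)%:~R) *m V by rewrite mulmxK // mxE.
    by rewrite ev mulmx_sum_row; apply: eq_bigr => j _; rewrite mxE.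
  apply: le_trans KK0; rewrite mxE; apply: le_trans (ler_norm_sum _ _ _) _.
  rewrite /K0 [leRHS](bigD1 i) //=.
  apply: (@le_trans _ _ (\sum_j (`|C| * `|invmx V j i|))); last first.
    rewrite lerDl.
    by apply: sumr_ge0 => i' _; apply: sumr_ge0 => j _; rewrite mulr_ge0.
  apply: ler_sum => j _; rewrite normrM ler_wpM2r //.
  exact: le_trans (vC j) (ler_norm _).
have zK' i : (0 <= z i + K%:Z) && (z i + K%:Z <= (K + K)%:Z).
  have := zK i; rewrite -intr_norm -[K%:R]/((K%:Z)%:~R) ler_int ler_norml PoszD.
  by move=> /andP[]; lia.
have fP i : (absz (z i + K%:Z)%R < (K + K).+1)%N by have := zK' i; lia.
pose f := [ffun i => Ordinal (fP i)].
have -> : v = pt f.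
  rewrite ev /pt; apply: eq_bigr => i _; rewrite ffunE /= gez0_abs.
    by rewrite addrK.
  by have /andP[] := zK' i.
exact: heta.
Qed.

Section DiscreteFunctional.
Variable c : 'rV[R]_n.

(** Amounts to [u] lying in the real span of the lattice points on which [c]
   vanishes, phrased so that no basis of that span has to be chosen. *)
Definition approximable u : Prop := exists C, forall r : R,
  exists z, [/\ L z, dotp c z = 0 & coord_bounded (r *: u - z) C].

Lemma approximable_lattice z : L z -> dotp c z = 0 -> approximable z.
Proof.
move=> Lz cz; have [C zC] := coord_bounded_ex z; exists C => r.
exists ((Num.floor r)%:~R *: z); split; first exact: lattice_mulz.
  by rewrite dotpZr cz mulr0.
move=> j; rewrite -scalerBl mxE normrM; apply: le_trans (zC j).
rewrite ler_piMl // ger0_norm ?subr_ge0 ?floor_le // lerBlDl.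
by have := floorD1_gt r; rewrite intrD => /ltW.
Qed.

Lemma approximableZ t u : approximable u -> approximable (t *: u).
Proof. by move=> [C h]; exists C => r; rewrite scalerA; exact: h. Qed.

Lemma approximableD u v : approximable u -> approximable v -> approximable (u + v).
Proof.
move=> [C hu] [D hv]; exists (C + D) => r.
have [z [Lz cz uz]] := hu r; have [z' [Lz' cz' vz]] := hv r.
exists (z + z'); split; first exact: latticeD.
  by rewrite dotpDr cz cz' addr0.
by rewrite scalerDr opprD addrACA; exact: coord_boundedD.
Qed.

Lemma approximable_span (J : finType) (k : J -> 'rV[R]_n) :
  (forall j, approximable (k j)) ->
  exists C, forall r : J -> R,
    exists z, [/\ L z, dotp c z = 0 & coord_bounded (\sum_j r j *: k j - z) C].
Proof.
move=> hk; elim: (index_enum J) => [|j s [C IH]].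
  exists 0 => r; exists 0; split; [exact: lattice0|exact: dotp0r|].
  by move=> i; rewrite big_nil subr0 mxE normr0.
have [D hj] := hk j; exists (D + C) => r.
have [z [Lz cz zC]] := IH r; have [z' [Lz' cz' zD]] := hj (r j).
exists (z' + z); split; first exact: latticeD.
  by rewrite dotpDr cz cz' addr0.
by rewrite big_cons opprD addrACA; exact: coord_boundedD.
Qed.

(** Reducing a lattice vector modulo the lattice points killed by [c] keeps
   its value under [c] and bounds its coordinates, so small values vanish. *)
Lemma discrete_functional (J : finType) (k : J -> 'rV[R]_n) v0 :
  (forall j, approximable (k j)) -> dotp c v0 != 0 ->
  exists2 eta, 0 < eta & forall v (r : J -> R), L v ->
    v = (dotp c v / dotp c v0) *: v0 + \sum_j r j *: k j ->
    `|dotp c v| < eta -> dotp c v = 0.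
Proof.
move=> /approximable_span[C hC] cv0; have [D v0D] := coord_bounded_ex v0.
have [eta eta0 heta] := lattice_bounded_discrete c (D + C).
exists (Num.min eta `|dotp c v0|); first by rewrite lt_min eta0 normr_gt0.
move=> v r Lv ev; rewrite lt_min => /andP[lt_eta lt_v0].
have [z [Lz cz zC]] := hC r.
have cvz : dotp c (v - z) = dotp c v by rewrite dotpBr cz subr0.
rewrite -cvz; apply: heta; first exact: latticeB; last by rewrite cvz.
rewrite {1}ev -addrA; apply: coord_boundedD zC => j.
rewrite mxE !normrM normfV; apply: le_trans (v0D j).
by rewrite ler_piMl // ler_pdivrMr ?normr_gt0 // mul1r ltW.
Qed.

End DiscreteFunctional.
End Lattice.

Section TruncatedLattice.
Context {R : realType} {n : nat} (L S : set 'rV[R]_n) (latL : is_lattice L).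
Hypothesis S_diff : forall s s', S s -> S s' -> L (s' - s).
Implicit Types (x y z : 'rV[R]_n).

(** A face of the convex hull of [S] is the convex hull of the points of [S]
   on it, so its directions are spanned by lattice vectors. *)
Lemma approximable_face c e x y :
  (forall s, S s -> dotp c s <= e) ->
  convex_hull S x -> convex_hull S y -> dotp c x = e -> dotp c y = e ->
  approximable L c (y - x).
Proof.
move=> Se Hx Hy cx cy.
have [s0 Ss0 cs0] : exists2 s, S s & dotp c s = e.
  apply: contrapT => none.
  suff /(_ x Hx) : convex_hull S `<=` [set z | dotp c z < e].
    by rewrite /= cx ltxx.
  apply: hull_min => [|s Ss /=].
    apply/convexP => u v t t0 t1 /= hu hv; rewrite !dotpr.
    by have [->|] := eqVneq t 1; [lra|move=> /eqP t'1]; nra.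
  rewrite lt_neqAle Se // andbT.
  by apply/eqP => cs; apply: none; exists s.
have hull z : convex_hull S z -> dotp c z = e -> approximable L c (z - s0).
  pose G := [set z | dotp c z <= e /\ (dotp c z = e -> approximable L c (z - s0))].
  suff GS : convex_hull S `<=` G by move=> /GS[].
  apply: hull_min => [|s Ss]; last first.
    split; first exact: Se.
    move=> cs; apply: approximable_lattice => //; first exact: S_diff.
    by rewrite dotpBr cs cs0 subrr.
  apply/convexP => u v t t0 t1 [ue Gu] [ve Gv]; split; rewrite !dotpr; first by nra.
  have [->|tn0] := eqVneq t 0.
    by rewrite scale0r subr0 scale1r !add0r mul0r add0r mul1r.
  have [->|tn1] := eqVneq t 1.
    by rewrite subrr !scale0r !addr0 scale1r mul0r addr0 mul1r.
  have {}t0 : 0 < t by rewrite lt_neqAle eq_sym tn0.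
  have {}t1 : 0 < 1 - t by rewrite subr_gt0 lt_neqAle tn1.
  move=> eq_e; have cu : dotp c u = e by nra.
  have cv : dotp c v = e by nra.
  have -> : t *: u + (1 - t) *: v - s0 = t *: (u - s0) + (1 - t) *: (v - s0).
    by rewrite !scalerBr addrACA -opprD -scalerDl [t + _]addrC subrK scale1r.
  by apply: approximableD => //; apply: approximableZ; [exact: Gu|exact: Gv].
have -> : y - x = (y - s0) + (-1) *: (x - s0).
  by rewrite scaleN1r opprB addrA subrK.
by apply: approximableD => //; [|apply: approximableZ]; exact: hull.
Qed.

Lemma irredundant_description (m : nat) (d : 'I_m -> 'rV[R]_n) (e : 'I_m -> R) P :
  P = [set x | forall i, dotp (d i) x <= e i] ->
  exists A : {set 'I_m}, P = [set x | forall i, i \in A -> dotp (d i) x <= e i] /\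
    forall i, i \in A -> exists2 y, e i < dotp (d i) y &
      forall j, j \in A -> j != i -> dotp (d j) y <= e j.
Proof.
move=> eP; pose describes (A : {set 'I_m}) :=
  `[< P = [set x | forall i, i \in A -> dotp (d i) x <= e i] >].
have [|A /minsetP[/asboolP dA minA]] := @ex_minset _ describes.
  exists [set: 'I_m]%SET; apply/asboolP; rewrite eP; apply/seteqP.
  by split=> x /= h i; [move=> _|]; apply: h; rewrite ?inE.
exists A; split=> // i iA; apply: contrapT => none.
suff /minA/(_ (subD1set _ _))/setP/(_ i) : describes (A :\ i).
  by rewrite !inE eqxx iA.
apply/asboolP/seteqP; split=> [x Px j|x hx].
  by rewrite inE => /andP[_ jA]; move: Px; rewrite dA; exact.
rewrite dA => j jA; have [->|ji] := eqVneq j i; last by apply: hx; rewrite !inE ji.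
rewrite leNgt; apply/negP => lt_x; apply: none; exists x => // j' j'A j'i.
by apply: hx; rewrite !inE j'i.
Qed.

(** Unless its functional is constant on [S], an irredundant inequality of the
   hull of [S] defines a facet of the hull. The directions of this facet are
   spanned by lattice vectors, which makes the functional discrete on [S]. *)
Lemma hull_functional_discrete (m : nat) (d : 'I_m -> 'rV[R]_n) (e : 'I_m -> R)
    (A : {set 'I_m}) (l : 'I_m) y :
  convex_hull S = [set x | forall i, i \in A -> dotp (d i) x <= e i] ->
  l \in A -> e l < dotp (d l) y ->
  (forall j, j \in A -> j != l -> dotp (d j) y <= e j) ->
  exists2 eta, 0 < eta & forall s s', S s -> S s' ->
    dotp (d l) (s' - s) < eta -> dotp (d l) (s' - s) <= 0.
Proof.
move=> eP lA ly hy.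
have SP s : S s -> forall i, i \in A -> dotp (d i) s <= e i.
  by move=> /sub_hull; rewrite eP.
have [const|/existsNP[sa /existsNP[sb /not_implyP[Sa /not_implyP[Sb /eqP ab]]]]] :=
    pselect (forall s s', S s -> S s' -> dotp (d l) s = dotp (d l) s').
  by exists 1 => // s s' Ss Ss' _; rewrite dotpBr (const s s') // subrr.
(* inequalities outside [A] are made trivial *)
pose d' i := if i \in A then d i else 0.
pose e' i := if i \in A then e i else 0.
have [|x0 Px0 strict] := common_strict_point (c := d') (e := e')
    (@hull_convex _ _ S) (sub_hull Sa).
  move=> x; rewrite eP => Px i; rewrite /d' /e'; case: ifP => [/Px//|_].
  by rewrite dotpC dotp0r.
pose tight i := forall s, S s -> dotp (d i) s = e i.
have {}strict i : i \in A -> dotp (d i) x0 < e i \/ tight i.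
  move=> iA; have := strict i; rewrite /d' /e' iA => -[|h]; first by left.
  by right=> s /sub_hull; exact: h.
have x0l : dotp (d l) x0 < e l.
  by case: (strict l lA) => // h; case/eqP: ab; rewrite !h.
have den0 : 0 < dotp (d l) y - dotp (d l) x0 by lra.
(* The point [z] where the segment from the relative interior point [x0] to [y]
   crosses the hyperplane of the [l]-th inequality lies in the relative interior
   of the corresponding facet. *)
pose t := (e l - dotp (d l) x0) / (dotp (d l) y - dotp (d l) x0).
have t0 : 0 <= t by rewrite divr_ge0 ?ltW // subr_gt0.
have t1 : t < 1 by rewrite ltr_pdivrMr // mul1r; lra.
pose z := t *: y + (1 - t) *: x0.
have zl : dotp (d l) z = e l.
  have : t * (dotp (d l) y - dotp (d l) x0) = e l - dotp (d l) x0.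
    by rewrite divfK // lt0r_neq0.
  by rewrite /z !dotpr; lra.
have z_strict i : i \in A -> i != l -> dotp (d i) z < e i \/ tight i.
  move=> iA il; have [lt_i|] := strict i iA; last by right.
  left; rewrite /z !dotpr; have := hy i iA il.
  have : 0 < (1 - t) * (e i - dotp (d i) x0) by rewrite mulr_gt0 // subr_gt0.
  by nra.
have hull_tight i x : tight i -> convex_hull S x -> dotp (d i) x = e i.
  move=> ti Hx; have: [set x | dotp (d i) x = e i] x; last by [].
  apply: hull_min Hx => //; apply/convexP => u v r _ _ /= hu hv.
  by rewrite !dotpr hu hv; ring.
have Hx0 : convex_hull S x0 by [].
have Hz : convex_hull S z.
  rewrite eP => i iA; have [->|il] := eqVneq i l; first by rewrite zl.
  have [/ltW//|ti] := z_strict i iA il.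
  have := hy i iA il; rewrite /z !dotpr (hull_tight _ _ ti Hx0).
  by nra.
clearbody z.
(* The rows of [K] span the directions of the facet. *)
pose D := \matrix_(i < m, j < n)
  (if (i == l) || (i \in A) && `[< tight i >] then d i 0 j else 0).
have D_row i u : (i == l) || (i \in A) && `[< tight i >] ->
    dotp (d i) u = (u *m D^T) 0 i.
  by move=> h; rewrite dotpE mxE; apply: eq_bigr => j _; rewrite !mxE h mulrC.
pose K := kermx D^T; pose k j := row j K.
have kD j : k j *m D^T = 0 by rewrite /k -row_mul mulmx_ker row0.
have k_approx j : approximable L (d l) (k j).
  have kl : dotp (d l) (k j) = 0 by rewrite D_row ?eqxx // kD mxE.
  have [eps eps0 heps] : exists2 eps, 0 < eps & forall r : R, 0 < r -> r <= eps ->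
      forall i, i \in A -> dotp (d i) (z + r *: k j) <= e i.
    apply: all_small => i; have [->|il] := eqVneq i l.
      by exists 1 => // r _ _ _; rewrite !dotpr kl mulr0 addr0 zl.
    have [iA|] := boolP (i \in A); last by exists 1.
    have [lt_i|ti] := z_strict i iA il.
      set v := dotp (d i) (k j); have v1 : 0 < 1 + `|v| by rewrite ltr_pwDl.
      exists ((e i - dotp (d i) z) / (1 + `|v|)); first by rewrite divr_gt0 ?subr_gt0.
      move=> r r0; rewrite ler_pdivlMr // !dotpr -/v => h _.
      by have := ler_norm v; nra.
    exists 1 => // r _ _ _; rewrite !dotpr (hull_tight _ _ ti Hz).
    by rewrite [dotp _ (k j)]D_row ?kD ?mxE ?mulr0 ?addr0 // iA (asboolT ti) orbT.
  have -> : k j = eps^-1 *: (z + eps *: k j - z).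
    by rewrite addrC addKr scalerA mulVf ?scale1r // lt0r_neq0.
  apply: approximableZ => //; apply: (approximable_face _ Hz _ zl).
  - by move=> s Ss; exact: SP.
  - by rewrite eP; exact: heps.
  - by rewrite !dotpr kl mulr0 addr0 zl.
have v0 : dotp (d l) (sb - sa) != 0 by rewrite dotpBr subr_eq0 eq_sym.
have [eta eta0 heta] := discrete_functional latL k_approx v0.
exists eta => // s s' Ss Ss' lt_eta; rewrite leNgt; apply/negP => gt0.
set v := s' - s in lt_eta gt0 *.
pose u := v - (dotp (d l) v / dotp (d l) (sb - sa)) *: (sb - sa).
have /sub_kermxP/submxP[r ur] : u *m D^T = 0.
  apply/rowP => i; rewrite [RHS]mxE.
  have [h|/negbTE h] := boolP ((i == l) || (i \in A) && `[< tight i >]); last first.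
    by rewrite mxE big1 // => j _; rewrite !mxE h mulr0.
  rewrite -D_row // /u [dotp (d i) _]dotpBr [dotp (d i) (_ *: _)]dotpZr.
  case/orP: h => [/eqP->|/andP[iA /asboolP ti]]; first by rewrite divfK ?subrr.
  by rewrite /v !dotpBr !ti // !subrr mulr0 subr0.
suff v_eq0 : dotp (d l) v = 0 by rewrite v_eq0 ltxx in gt0.
apply: (heta v (fun j => r 0 j)); [exact: S_diff| |by rewrite gtr0_norm].
rewrite -[LHS](subrK ((dotp (d l) v / dotp (d l) (sb - sa)) *: (sb - sa))) addrC -/u.
by congr (_ + _); rewrite ur mulmx_sum_row.
Qed.

End TruncatedLattice.

(** Along an ultrafilter the functionals of an irredundant description increase
   arbitrarily little, hence not at all because they take discrete values; a
   difference on which they are all nonpositive is a recession direction of the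
   hull, so it translates [S] into itself. *)
Lemma truncated_lattice_wqo {R : realType} {n : nat} (S : set 'rV[R]_n) :
  polyhedrally_truncated_affine_lattice S -> translation_wqo S.
Proof.
move=> [[L [b [C [latL _ cC eS]]]] [m [d [e eP]]]] U s UU Ss.
have S_diff x y : S x -> S y -> L (y - x).
  rewrite eS => -[[u Lu <-] _] [[v Lv <-] _].
  by rewrite opprD addrACA subrr add0r; exact: latticeB.
have [A [eA irr]] := irredundant_description eP.
have : U [set m | U [set m' | forall l, l \in A -> dotp (d l) (s m' - s m) <= 0]].
  apply: (@ultra_forall2 U UU _
    (fun l m m' => l \in A -> dotp (d l) (s m' - s m) <= 0)) => l.
  have [lA|nlA] := boolP (l \in A); last by apply: filterE => p; apply: filterE.
  have [y ly hy] := irr l lA.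
  have [eta eta0 heta] := hull_functional_discrete latL S_diff eA lA ly hy.
  have sM p : dotp (d l) (s p) <= e l.
    by have := sub_hull (Ss p); rewrite eA; exact.
  apply: filterS (ultra_small_increase sM eta0) => p; apply: filterS => q /= h _.
  by apply: heta; rewrite // dotpBr.
apply: filterS => p; apply: filterS => q /= hw x Sx.
have Hxw : convex_hull S (x + (s q - s p)).
  rewrite eA => l lA; rewrite dotpDr.
  have := sub_hull Sx; rewrite eA => /(_ l lA); have := hw l lA.
  by lra.
have SC : S `<=` C by rewrite eS; exact: subIsetr.
rewrite eS; split; last exact: hull_min Hxw.
move: Sx; rewrite {1}eS => -[[u Lu ux] _].
by exists (u + (s q - s p)); [apply: latticeD => //; exact: S_diff|rewrite addrA ux].
Qed.

(** * The coproduct of two [S]-free polyhedra *)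

(** Points of [S1] and [S2] in the relative interiors of two facets pair up to a
   point in the relative interior of the corresponding facet of the coproduct. *)
Lemma maximal_S_free_coproduct {R : realType} {n1 n2 : nat} (I1 I2 : finType)
    (a1 : I1 -> 'rV[R]_n1) (a2 : I2 -> 'rV[R]_n2)
    (S1 : set 'rV[R]_n1) (S2 : set 'rV[R]_n2) (mu : R) :
  0 < mu -> mu < 1 ->
  (forall k, exists x, strict_at a1 k x) -> (forall k, exists x, strict_at a2 k x) ->
  polyhedrally_truncated_affine_lattice S1 ->
  polyhedrally_truncated_affine_lattice S2 ->
  maximal_S_free S1 (unit_halfspaces a1) ->
  maximal_S_free S2 (unit_halfspaces a2) ->
  maximal_S_free (prod_set S1 S2) (unit_halfspaces (coproduct_normal a1 a2 mu)).
Proof.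
move=> mu0 mu1 st1 st2 /truncated_lattice_wqo wqo1 /truncated_lattice_wqo wqo2.
move=> max1 max2; apply: maximal_S_free_of_strict.
  exact: S_free_coproduct max1.1 max2.1.
move=> [k1 k2].
have [s1 S1s st_s1] := facet_attained max1 st1 wqo1 k1.
have [s2 S2s st_s2] := facet_attained max2 st2 wqo2 k2.
exists (row_mx s1 s2); first by rewrite /prod_set /= row_mxKl row_mxKr.
by apply: strict_at_coproduct; rewrite ?row_mxKl ?row_mxKr.
Qed.

Theorem theorem4p1 (R : realType) (n1 n2 : nat) (I1 I2 : finType)
    (a1 : I1 -> 'rV[R]_n1) (a2 : I2 -> 'rV[R]_n2)
    (B1 S1 : set 'rV[R]_n1) (B2 S2 : set 'rV[R]_n2) (mu : R)
    (hB1 : facet_presentation a1 B1) (hB2 : facet_presentation a2 B2)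
    (hS1 : polyhedrally_truncated_affine_lattice S1)
    (hS2 : polyhedrally_truncated_affine_lattice S2)
    (mu_gt0 : 0 < mu) (mu_lt1 : mu < 1) :
  let B := coproduct (scale_set mu^-1 B1) (scale_set (1 - mu)^-1 B2) in
  let S := prod_set S1 S2 in
  [/\ (S_free S1 B1 -> S_free S2 B2 -> S_free S B),
      (maximal_S_free S1 B1 -> maximal_S_free S2 B2 -> maximal_S_free S B)
    & (maximal_S_free S1 B1 -> covering_property S1 B1 ->
       maximal_S_free S2 B2 -> covering_property S2 B2 ->
       maximal_S_free S B /\ covering_property S B)].
Proof.
move=> B S; have [eB _] := coproduct_presentation mu_gt0 mu_lt1 hB1 hB2.
have [eB1 st1] := facet_presentationE hB1; have [eB2 st2] := facet_presentationE hB2.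
have maxB : maximal_S_free S1 B1 -> maximal_S_free S2 B2 -> maximal_S_free S B.
  by rewrite /B eB eB1 eB2; exact: maximal_S_free_coproduct.
split=> // [|max1 cov1 max2 cov2].
  by rewrite /B eB eB1 eB2; exact: S_free_coproduct.
by split; [exact: maxB|exact: covering_property_coproduct].
Qed.
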